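(* Let $\varphi$ be a bounded measurable complex-valued function on the unit circle with Fourier coefficients $(c_k)_{k\in\mathbf{Z}}$, such that the infinite Toeplitz matrix $T(\varphi)=(c_{i-j})_{i,j\ge 0}$ is invertible on $\ell^2(\mathbf{Z}^+)$. Let $\varphi=\varphi^-\varphi^+$ be a Wiener-Hopf factorization of $\varphi$. Let $m\ge 1$ be an integer and let $(p_i)_{i\ge 0}$ and $(q_i)_{i\ge 0}$ be sequences of integers with $p_i=q_i=i$ for all $i\ge m$. For $n\ge 1$ put \[M_{m+n}=(c_{p_i-q_j})_{i,j=0,\ldots,m+n-1},\qquad T_n(\varphi)=(c_{i-j})_{i,j=0,\ldots,n-1}.\] If the matrices $T_n(\varphi)$ are uniformly invertible, then \[\lim_{n\to\infty}\frac{\det M_{m+n}}{\det T_n(\varphi)}=\det\left(\sum_{k=1}^{\infty}(\varphi^-)_{p_i+k-m}\,(\varphi^+)_{-q_j-k+m}\right)_{i,j=0,\ldots,m-1},\] where a subscript $k$ on a function denotes its $k$-th Fourier coefficient.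
   Context: Fourier coefficients: for an integrable function $f$ on the unit circle, $f_k=\frac{1}{2\pi}\int_0^{2\pi} f(e^{i\theta})e^{-ik\theta}\,d\theta$ for $k\in\mathbf{Z}$; in particular $c_k=\varphi_k$. Here $\mathbf{Z}^+=\{0,1,2,\ldots\}$. $H^2$ is the space of $L^2$ functions on the unit circle whose Fourier coefficients with negative index all vanish, and $\overline{H^2}$ is the space of complex conjugates of functions in $H^2$ (the $L^2$ functions whose Fourier coefficients with positive index all vanish). Wiener-Hopf factorization: a factorization $\varphi=\varphi^-\varphi^+$ (almost everywhere on the circle) in which $\varphi^+$ and $(\varphi^+)^{-1}$ belong to $H^2$ and $\varphi^-$ and $(\varphi^-)^{-1}$ belong to $\overline{H^2}$. Such a factorization exists whenever $T(\varphi)$ is invertible on $\ell^2(\mathbf{Z}^+)$. Uniform invertibility: the matrices $T_n(\varphi)$ are called uniformly invertible if there is $N$ such that $T_n(\varphi)$ is invertible for all $n\ge N$ and the operator norms (with respect to the Euclidean norm on $\mathbf{C}^n$) of the inverses $T_n(\varphi)^{-1}$, $n\ge N$, are bounded. The quotient in the limit is thus defined for all sufficiently large $n$. The sum over $k$ has only finitely many nonzero terms for each $i,j$, since $(\varphi^-)_k=0$ for $k>0$ and $(\varphi^+)_k=0$ for $k<0$. *)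

(* Defs.v *)
From HB Require Import structures.
From mathcomp Require Import all_boot all_order all_algebra.
From mathcomp Require Import complex.
From mathcomp Require Import all_classical all_reals all_analysis.

Set Implicit Arguments.
Unset Strict Implicit.
Unset Printing Implicit Defensive.

Import Order.TTheory GRing.Theory Num.Theory.
Import numFieldNormedType.Exports.
Import Normc.

Local Open Scope classical_set_scope.
Local Open Scope complex_scope.
Local Open Scope ring_scope.

(* A function on the unit circle is represented by a function R[i] -> R[i],
   of which only the values at the points [expi t], 0 <= t <= 2 pi, are ever
   used.  The measure on the circle is Lebesgue measure in t. *)
Section Circle.
Variable R : realType.
Implicit Types (f g : R[i] -> R[i]) (t : R) (k : int).

Definition expi t : R[i] := cos t +i* sin t.

Definition angles : set R := `[0, 2 * pi]%classic.

Definition circle_measurable f : Prop :=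
  measurable_fun angles (fun t => complex.Re (f (expi t))) /\
  measurable_fun angles (fun t => complex.Im (f (expi t))).

Definition circle_bounded f : Prop :=
  exists K : R, forall t, angles t -> normc (f (expi t)) <= K.

Definition circle_ae (P : R[i] -> Prop) : Prop :=
  {ae lebesgue_measure, forall t : R, angles t -> P (expi t)}.

Definition fourier f k : R[i] :=
  let h t := f (expi t) * expi (- (k%:~R * t)) in
  ((2 * pi)^-1)%:C *
  (Rintegral lebesgue_measure angles (fun t => complex.Re (h t)) +i*
   Rintegral lebesgue_measure angles (fun t => complex.Im (h t))).

Definition circle_L2 f : Prop :=
  circle_measurable f /\
  (\int[lebesgue_measure]_(t in angles) (normc (f (expi t)) ^+ 2)%:E < +oo)%E.

Definition H2 f : Prop :=
  circle_L2 f /\ forall k, k < 0 -> fourier f k = 0.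

Definition H2bar f : Prop := exists2 g, H2 g & f =1 (fun z => conjc (g z)).

(* Since 0^-1 = 0 in a field, the existence of the reciprocals has to be
   required separately, as almost everywhere nonvanishing. *)
Definition wiener_hopf f fm fp : Prop :=
  [/\ circle_ae (fun z => f z = fm z * fp z),
      circle_ae (fun z => fp z != 0) /\ circle_ae (fun z => fm z != 0),
      H2 fp /\ H2 (fun z => (fp z)^-1) &
      H2bar fm /\ H2bar (fun z => (fm z)^-1)].

End Circle.

(* Infinite complex series: the limit of the partial sums.  R[i]^o is R[i]
   with the topology of its norm. *)
Definition cseries (R : realType) (m : nat) (u : nat -> R[i]) : R[i] :=
  limn (fun n => \sum_(m <= k < n) u k : R[i]^o).

Section SquareSummable.
Variable R : realType.
Implicit Types (u v : nat -> R[i]) (A B : (nat -> R[i]) -> nat -> R[i]).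

Definition l2 u : Prop := (\sum_(0 <= k <oo) (normc (u k) ^+ 2)%:E < +oo)%E.

Definition l2norm u : R :=
  Num.sqrt (fine (\sum_(0 <= k <oo) (normc (u k) ^+ 2)%:E)%E).

(* Operators on l2 are functions on all sequences, of which only the
   restriction to l2 matters. *)
Definition l2_bounded_linear A : Prop :=
  [/\ forall u, l2 u -> l2 (A u),
      forall (a : R[i]) u v, l2 u -> l2 v ->
        A (fun k => a * u k + v k) =1 (fun k => a * A u k + A v k) &
      exists K : R, forall u, l2 u -> l2norm (A u) <= K * l2norm u].

Definition l2_invertible A : Prop :=
  l2_bounded_linear A /\
  exists B, l2_bounded_linear B /\
    forall u, l2 u -> B (A u) =1 u /\ A (B u) =1 u.

End SquareSummable.

Section Toeplitz.
Variable R : realType.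
Implicit Types (f : R[i] -> R[i]) (n : nat).

Definition toeplitz_op f (u : nat -> R[i]) (i : nat) : R[i] :=
  cseries 0 (fun j => fourier f (i%:Z - j%:Z) * u j).

Definition toeplitz_mx f n : 'M[R[i]]_n :=
  \matrix_(i < n, j < n) fourier f (i%:Z - j%:Z).

Definition cvnorm n (x : 'cV[R[i]]_n) : R :=
  Num.sqrt (\sum_(i < n) normc (x i 0) ^+ 2).

(* Extended-real-valued, so that no finiteness has to be known beforehand. *)
Definition opnorm n (A : 'M[R[i]]_n) : \bar R :=
  ereal_sup [set (cvnorm (A *m x))%:E | x in [set x | cvnorm x <= 1]].

Definition uniformly_invertible (T : forall n, 'M[R[i]]_n) : Prop :=
  exists N : nat,
    (forall n, (N <= n)%N -> T n \in unitmx) /\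
    exists K : R, forall n, (N <= n)%N -> (opnorm (invmx (T n)) <= K%:E)%E.

End Toeplitz.

(* Main.v *)
Require Import Defs.
From mathcomp Require Import all_boot all_order all_algebra.
From mathcomp Require Import complex.
From mathcomp Require Import all_classical all_reals all_analysis.
From mathcomp Require Import measurable_realfun ring lra zify.
Import Order.TTheory GRing.Theory Num.Theory.
Import numFieldNormedType.Exports.
Import Normc.
Local Open Scope classical_set_scope.
Local Open Scope ring_scope.

(** Deleting the first m rows and columns of M_{m+n} leaves T_n(phi).  Hence the
quotient of determinants is the determinant of an m by m Schur complement
([det_schur]), with entries
   c_{p_i - q_j} - sum_{k, l < n} c_{p_i - m - k} (T_n^-1)_{k l} c_{m + l - q_j}.
Uniform invertibility is what allows T_n^-1 to be replaced by T^-1 as n grows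
([finite_section]).  So the entry (i, j) converges to r_{p_i - m}, where, with
q = q_j - m, the square-summable x solves T(phi) x = (c_{l - q})_{l >= 0} and
   r_p = c_{p - q} - sum_{k >= 0} c_{p - k} x_k          ([residual]).

The factorization evaluates r.  Let h be the analytic function with
coefficients x_k.  Then r is the coefficient sequence of phi (z^q - h), and
r_p = 0 for p >= 0 by the choice of x.  Division by phim gives the function
phip (z^q - h), which is also strictly anti-analytic, and whose coefficients at
negative p are those of z^q phip, because phip h is analytic
([residual_convolution]).  Multiplication by phim then yields
   r_p = sum_{k >= 1} phim_{p + k} phip_{- k - q}          ([residual_sum]).
Both steps are carried out on coefficients.  A product of strictly
anti-analytic series with an anti-analytic one has coefficients that are finite
sums, so only one interchange of infinite sums is left ([phim_inv_toeplitz]);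
it follows from the boundedness of T(phi), and no function h is ever
constructed.

From Fourier analysis this takes Bessel's inequality and the convolution formula
for the coefficients of a product of two square-integrable functions, one of
which is anti-analytic ([coef_mul_cvg]).  The latter rests on the L2 density of
trigonometric polynomials ([sqint_approximable]), obtained from dominated
convergence: explicit powers of trigonometric polynomials converge to the
indicators of arcs, Dynkin's lemma extends this to Borel sets, and simple
functions do the rest. *)

Set Implicit Arguments.
Unset Strict Implicit.
Unset Printing Implicit Defensive.

(** * Complex numbers and limits of complex sequences *)

Section ComplexNumbers.
Local Open Scope complex_scope.
Variable R : realType.
Implicit Types (z w : R[i]).
Local Notation Re := complex.Re.
Local Notation Im := complex.Im.

Lemma eq_complexP z w : Re z = Re w -> Im z = Im w -> z = w.
Proof. by case: z; case: w => /= ? ? ? ? -> ->. Qed.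

Lemma cReD z w : Re (z + w) = Re z + Re w. Proof. by case: z; case: w. Qed.
Lemma cImD z w : Im (z + w) = Im z + Im w. Proof. by case: z; case: w. Qed.
Lemma cReB z w : Re (z - w) = Re z - Re w. Proof. by case: z; case: w. Qed.
Lemma cImB z w : Im (z - w) = Im z - Im w. Proof. by case: z; case: w. Qed.
Lemma cReM z w : Re (z * w) = Re z * Re w - Im z * Im w.
Proof. by case: z; case: w. Qed.
Lemma cImM z w : Im (z * w) = Re z * Im w + Im z * Re w.
Proof. by case: z; case: w. Qed.
Lemma cReJ z : Re (conjc z) = Re z. Proof. by case: z. Qed.
Lemma cImJ z : Im (conjc z) = - Im z. Proof. by case: z. Qed.

Lemma normc_sqr z : normc z ^+ 2 = Re z ^+ 2 + Im z ^+ 2.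
Proof. by case: z => a b; rewrite /normc sqr_sqrtr// addr_ge0// sqr_ge0. Qed.

Lemma normc_ge0 z : 0 <= normc z.
Proof. by case: z => a b; rewrite /normc sqrtr_ge0. Qed.

Lemma normc_le_ReIm z : normc z <= `|Re z| + `|Im z|.
Proof.
rewrite -(@ler_pXn2r _ 2) ?nnegrE ?normc_ge0 ?addr_ge0//.
rewrite normc_sqr -(real_normK (num_real (Re z))) -(real_normK (num_real (Im z))).
by have := normr_ge0 (Re z); have := normr_ge0 (Im z); nra.
Qed.

Lemma normRe_le z : `|Re z| <= normc z.
Proof.
rewrite -(@ler_pXn2r _ 2) ?nnegrE ?normc_ge0 //.
by rewrite normc_sqr -normrX ger0_norm ?sqr_ge0// lerDl sqr_ge0.
Qed.

Lemma normIm_le z : `|Im z| <= normc z.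
Proof.
rewrite -(@ler_pXn2r _ 2) ?nnegrE ?normc_ge0 //.
by rewrite normc_sqr -normrX ger0_norm ?sqr_ge0// lerDr sqr_ge0.
Qed.

Lemma mulcJ z : z * conjc z = (normc z ^+ 2)%:C.
Proof.
rewrite normc_sqr; apply: eq_complexP; rewrite ?cReM ?cImM cReJ cImJ /=; ring.
Qed.

Definition expz (k : int) (t : R) : R[i] := expi (k%:~R * t).

Lemma expz0 t : expz 0 t = 1.
Proof. by rewrite /expz mul0r /expi cos0 sin0. Qed.

Lemma expzD j k t : expz (j + k) t = expz j t * expz k t.
Proof.
apply: eq_complexP; rewrite ?cReM ?cImM /= intrD mulrDl ?cosD ?sinD//.
by rewrite addrC; congr (_ + _); rewrite mulrC.
Qed.

Lemma expz_conj k t : conjc (expz k t) = expz (- k) t.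
Proof. by rewrite /expz rmorphN mulNr /expi/= cosN sinN. Qed.

Lemma expzN k t : expi (- (k%:~R * t)) = expz (- k) t.
Proof. by rewrite /expz rmorphN mulNr. Qed.

End ComplexNumbers.

Section ComplexLimits.
Local Open Scope complex_scope.
Variable R : realType.
Implicit Types (u v : nat -> R[i]).

(** Convergence is stated with the real-valued modulus, so that all estimates
take place in R; [ccvg_cvg] returns to the topology of the complex field. *)
Definition ccvg (u : nat -> R[i]) (l : R[i]) : Prop :=
  forall e : R, 0 < e -> exists N : nat, forall n, (N <= n)%N -> normc (u n - l) < e.

Lemma normc_real (x : R) : normc x%:C = `|x|.
Proof. by rewrite /normc/= expr0n/= addr0 sqrtr_sqr. Qed.

Lemma norm_normc (z : R[i]) : `|z| = (normc z)%:C.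
Proof. by case: z. Qed.

Lemma normcB z w : normc (z - w) = normc (w - z) :> R.
Proof. by rewrite -normcN opprB. Qed.

Lemma normc_eq0 (z : R[i]) : (forall e : R, 0 < e -> normc z < e) -> z = 0.
Proof.
move=> h; apply: eq0_normc; apply/eqP; rewrite eq_le normc_ge0 andbT leNgt.
by apply/negP => /h; rewrite ltxx.
Qed.

Lemma ccvg_unique u a b : ccvg u a -> ccvg u b -> a = b.
Proof.
move=> ua ub; apply/eqP; rewrite -subr_eq0; apply/eqP/normc_eq0 => e e0.
have e2 : 0 < e / 2 by rewrite divr_gt0.
have [[N1 h1] [N2 h2]] := (ua _ e2, ub _ e2).
pose n := maxn N1 N2.
have -> : a - b = (a - u n) + (u n - b) by rewrite addrA subrK.
apply: le_lt_trans (le_normcD _ _) _.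
rewrite [normc (a - _)]normcB.
by have := h1 n (leq_maxl _ _); have := h2 n (leq_maxr _ _); lra.
Qed.

Lemma ccvg_near u l (N : nat) : (forall n, (N <= n)%N -> u n = l) -> ccvg u l.
Proof. by move=> h e e0; exists N => n /h ->; rewrite subrr normc0. Qed.

Lemma ccvg_cst (l : R[i]) : ccvg (fun=> l) l.
Proof. exact: (@ccvg_near _ _ 0). Qed.

Lemma eq_ccvg u v l : (forall n, u n = v n) -> ccvg u l -> ccvg v l.
Proof. by move=> /funext ->. Qed.

Lemma ccvgD u v a b : ccvg u a -> ccvg v b -> ccvg (fun n => u n + v n) (a + b).
Proof.
move=> ua vb e e0; have e2 : 0 < e / 2 by rewrite divr_gt0.
have [[N1 h1] [N2 h2]] := (ua _ e2, vb _ e2).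
exists (maxn N1 N2) => n; rewrite geq_max => /andP[/h1 n1 /h2 n2].
rewrite opprD addrACA; apply: le_lt_trans (le_normcD _ _) _; lra.
Qed.

Lemma ccvg_mull c u a : ccvg u a -> ccvg (fun n => c * u n) (c * a).
Proof.
move=> ua e e0; have c0 : 0 < normc c + 1 by rewrite ltr_wpDl// normc_ge0.
have [|N h] := ua (e / (normc c + 1)); first by rewrite divr_gt0.
exists N => n /h; rewrite -mulrBr normcM ltr_pdivlMr//.
by have := normc_ge0 (u n - a); have := normc_ge0 c; nra.
Qed.

Lemma ccvgM u v a b : ccvg u a -> ccvg v b -> ccvg (fun n => u n * v n) (a * b).
Proof.
move=> ua vb.
have prod0 : ccvg (fun n => (u n - a) * (v n - b)) 0.
  move=> e e0; have [N1 h1] := ua _ e0; have [N2 h2] := vb _ ltr01.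
  exists (maxn N1 N2) => n; rewrite geq_max => /andP[/h1 n1 /h2 n2].
  rewrite subr0 normcM; have := normc_ge0 (u n - a); have := normc_ge0 (v n - b); nra.
have h := ccvgD (ccvgD prod0 (ccvg_mull a vb)) (ccvgD (ccvg_mull b ua) (ccvg_cst (- (a * b)))).
have -> : a * b = 0 + a * b + (b * a + - (a * b)) by ring.
by apply: eq_ccvg h => n; ring.
Qed.

Lemma ccvgB u v a b : ccvg u a -> ccvg v b -> ccvg (fun n => u n - v n) (a - b).
Proof.
move=> ua /(ccvg_mull (-1))/(ccvgD ua); rewrite mulN1r.
by apply: eq_ccvg => n; rewrite mulN1r.
Qed.

Lemma ccvg_sum (I : Type) (s : seq I) (F : nat -> I -> R[i]) (l : I -> R[i]) :
  (forall i, ccvg (F ^~ i) (l i)) ->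
  ccvg (fun n => \sum_(i <- s) F n i) (\sum_(i <- s) l i).
Proof.
move=> h; elim: s => [|i s IH].
  by rewrite big_nil; apply: eq_ccvg (ccvg_cst 0) => n; rewrite big_nil.
by rewrite big_cons; apply: eq_ccvg (ccvgD (h i) IH) => n; rewrite big_cons.
Qed.

Lemma ccvg_prod (I : Type) (s : seq I) (F : nat -> I -> R[i]) (l : I -> R[i]) :
  (forall i, ccvg (F ^~ i) (l i)) ->
  ccvg (fun n => \prod_(i <- s) F n i) (\prod_(i <- s) l i).
Proof.
move=> h; elim: s => [|i s IH].
  by rewrite big_nil; apply: eq_ccvg (ccvg_cst 1) => n; rewrite big_nil.
by rewrite big_cons; apply: eq_ccvg (ccvgM (h i) IH) => n; rewrite big_cons.
Qed.

Lemma ccvg_det m (X : nat -> 'M[R[i]]_m) (Y : 'M[R[i]]_m) :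
  (forall i j, ccvg (fun n => X n i j) (Y i j)) ->
  ccvg (fun n => \det (X n)) (\det Y).
Proof.
move=> h; rewrite /determinant; apply: ccvg_sum => s.
by apply: ccvg_mull; apply: ccvg_prod => i.
Qed.

Lemma ccvg_ext_near u v l (N : nat) : (forall n, (N <= n)%N -> u n = v n) ->
  ccvg u l -> ccvg v l.
Proof.
move=> uv ul e e0; have [N1 h] := ul _ e0.
by exists (maxn N N1) => n; rewrite geq_max => /andP[/uv <- /h].
Qed.

Lemma ccvg_addn u l (N : nat) : ccvg u l -> ccvg (fun n => u (n + N)%N) l.
Proof.
move=> ul e e0; have [N1 h] := ul _ e0.
by exists N1 => n Nn; apply: h; apply: leq_trans Nn (leq_addr _ _).
Qed.

Lemma ccvg_cvg u l : ccvg u l -> (u : nat -> R[i]^o) @ \oo --> (l : R[i]^o).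
Proof.
move=> ul; apply/cvgrPdist_lt => e e0.
have er : e = (complex.Re e)%:C.
  by move: e0; rewrite ltcE/= => /andP[/eqP ie _]; apply: eq_complexP.
have re0 : 0 < complex.Re e by move: e0; rewrite ltcE => /andP[].
have [N h] := ul _ re0; exists N => // n /= /h.
by rewrite normcB er [`|_|]norm_normc ltcR.
Qed.

Lemma cseries_lim m u l : ccvg (fun n => \sum_(m <= k < n) u k) l -> cseries m u = l.
Proof. by move=> /ccvg_cvg /cvg_lim; apply; exact: norm_hausdorff. Qed.

End ComplexLimits.

(** * Square-summable sequences *)

Section SquareSummableSequences.
Local Open Scope complex_scope.
Variable R : realType.
Implicit Types (u v : nat -> R[i]).

Definition sqsum n u : R := \sum_(k < n) normc (u k) ^+ 2.

Lemma sqsum_ge0 n u : 0 <= sqsum n u.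
Proof. by apply: sumr_ge0 => k _; exact: sqr_ge0. Qed.

Lemma sqsum_le m n u : (m <= n)%N -> sqsum m u <= sqsum n u.
Proof.
move=> mn; rewrite /sqsum -(subnKC mn) big_split_ord /= lerDl.
by apply: sumr_ge0 => k _; exact: sqr_ge0.
Qed.

Lemma normc_sqr_le_sqsum n u k : (k < n)%N -> normc (u k) ^+ 2 <= sqsum n u.
Proof.
move=> kn; apply: le_trans (sqsum_le u kn); rewrite /sqsum big_ord_recr/= lerDr.
exact: sqsum_ge0.
Qed.

Let esq u : \bar R := (\sum_(0 <= k <oo) (normc (u k) ^+ 2)%:E)%E.

Let sqE n u : (\sum_(0 <= k < n) (normc (u k) ^+ 2)%:E)%E = (sqsum n u)%:E.
Proof. by rewrite big_mkord sumEFin. Qed.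

Let le_esq n u : ((sqsum n u)%:E <= esq u)%E.
Proof. by rewrite -sqE; apply: nneseries_lim_ge => k _ _; rewrite lee_fin sqr_ge0. Qed.

Let esq_le u (M : R) : (forall n, sqsum n u <= M) -> (esq u <= M%:E)%E.
Proof.
move=> uM; apply: lime_le.
  by apply: is_cvg_nneseries => k _ _; rewrite lee_fin sqr_ge0.
by apply: nearW => n; rewrite sqE lee_fin.
Qed.

Lemma l2_bounded u (M : R) : (forall n, sqsum n u <= M) -> l2 u.
Proof. by move=> /esq_le/le_lt_trans; apply; rewrite ltry. Qed.

Let esqE u : l2 u -> esq u = (l2norm u ^+ 2)%:E.
Proof.
move=> lu; have e0 : (0 <= esq u)%E.
  by apply: le_trans (le_esq 0 u); rewrite lee_fin sqsum_ge0.
have ef : esq u \is a fin_num by rewrite ge0_fin_numE.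
by rewrite /l2norm sqr_sqrtr ?fine_ge0// fineK.
Qed.

Lemma sqsum_le_l2norm n u : l2 u -> sqsum n u <= l2norm u ^+ 2.
Proof. by move=> lu; have := le_esq n u; rewrite esqE// lee_fin. Qed.

Lemma l2norm_le u (M : R) : (forall n, sqsum n u <= M) -> l2norm u ^+ 2 <= M.
Proof.
by move=> uM; have := esq_le uM; rewrite esqE ?lee_fin//; exact: l2_bounded uM.
Qed.

Lemma l2norm_ge0 u : 0 <= l2norm u. Proof. exact: sqrtr_ge0. Qed.

Definition trunc n u k : R[i] := if (k < n)%N then u k else 0.
Definition tail n u k : R[i] := if (k < n)%N then 0 else u k.

Lemma tail_trunc n u : u = (fun k => 1 * tail n u k + trunc n u k).
Proof.
by apply: funext => k; rewrite /tail /trunc mul1r; case: ifP; rewrite ?add0r ?addr0.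
Qed.

Lemma sqsum_tail n N u : (n <= N)%N -> sqsum N (tail n u) = sqsum N u - sqsum n u.
Proof.
move=> nN; rewrite /sqsum -(subnKC nN) !big_split_ord/=.
rewrite big1 => [|k _]; last by rewrite /tail ltn_ord normc0 expr0n.
rewrite add0r addrAC subrr add0r; apply: eq_bigr => k _.
by rewrite /tail ltnNge leq_addr.
Qed.

Lemma l2_le u v : (forall k, normc (v k) <= normc (u k)) -> l2 u -> l2 v.
Proof.
move=> vu lu; apply: (@l2_bounded _ (l2norm u ^+ 2)) => N.
apply: le_trans (sqsum_le_l2norm N lu); apply: ler_sum => k _.
by rewrite lerXn2r ?nnegrE ?normc_ge0.
Qed.

Lemma l2_tail n u : l2 u -> l2 (tail n u).
Proof.
apply: l2_le => // k; rewrite /tail; case: ifP => // _.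
by rewrite normc0 normc_ge0.
Qed.

Lemma l2_trunc n u : l2 u -> l2 (trunc n u).
Proof.
apply: l2_le => // k; rewrite /trunc; case: ifP => // _.
by rewrite normc0 normc_ge0.
Qed.

Lemma l2norm_tail u (e : R) : l2 u -> 0 < e ->
  exists N : nat, forall n, (N <= n)%N -> l2norm (tail n u) ^+ 2 <= e.
Proof.
move=> lu e0; have [N hN] : exists N, l2norm u ^+ 2 - e < sqsum N u.
  apply/not_existsP => h; have : l2norm u ^+ 2 <= l2norm u ^+ 2 - e.
    by apply: l2norm_le => n; rewrite leNgt; apply/negP; exact: h.
  by apply/negP; rewrite -ltNge gtrBl.
exists N => n Nn; apply: l2norm_le => k; apply: le_trans (sqsum_le _ (leq_maxr n k)) _.
rewrite sqsum_tail ?leq_maxl//; have := sqsum_le u Nn; have := sqsum_le_l2norm (maxn n k) lu.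
by lra.
Qed.

(** By continuity, A of the tails of u tends to 0 in l2; the bound is uniform in
the number M of terms that are kept. *)
Lemma bounded_linear_tail (A : (nat -> R[i]) -> nat -> R[i]) u (e : R) :
  l2_bounded_linear A -> l2 u -> 0 < e ->
  exists N : nat, forall n, (N <= n)%N -> forall M, sqsum M (A (tail n u)) <= e.
Proof.
move=> [Al2 _ [K AK]] lu e0; have K1 : 0 < K ^+ 2 + 1 by rewrite ltr_wpDl// sqr_ge0.
have [|N hN] := @l2norm_tail u (e / (K ^+ 2 + 1)) lu; first by rewrite divr_gt0.
exists N => n /hN; rewrite ler_pdivlMr// => tn M.
have lt := l2_tail n lu; apply: le_trans (sqsum_le_l2norm M (Al2 _ lt)) _.
have := AK _ lt; have := l2norm_ge0 (A (tail n u)); have := l2norm_ge0 (tail n u).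
move: tn; set a := l2norm (tail n u); set b := l2norm _ => tn a0 b0 bK.
have : b ^+ 2 <= (K * a) ^+ 2 by rewrite lerXn2r ?nnegrE// (le_trans b0).
rewrite exprMn; have := sqr_ge0 a; nra.
Qed.

Lemma bounded_linear_split (A : (nat -> R[i]) -> nat -> R[i]) u n k :
  l2_bounded_linear A -> l2 u -> A u k = A (tail n u) k + A (trunc n u) k.
Proof.
move=> [_ Alin _] lu; rewrite {1}(tail_trunc n u) Alin ?mul1r//.
  exact: l2_tail.
exact: l2_trunc.
Qed.

(** For a Toeplitz operator this says that the series defining its entries
converge, so that the limits in their definition are genuine. *)
Lemma bounded_linear_trunc_cvg (A : (nat -> R[i]) -> nat -> R[i]) u k :
  l2_bounded_linear A -> l2 u -> ccvg (fun n => A (trunc n u) k) (A u k).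
Proof.
move=> bA lu e e0; have [|N hN] := @bounded_linear_tail _ u ((e / 2) ^+ 2) bA lu.
  by rewrite exprn_gt0// divr_gt0.
exists N => n /hN /(_ k.+1) h; rewrite (bounded_linear_split n k bA lu).
rewrite opprD addrCA subrr addr0 normcN.
have : normc (A (tail n u) k) ^+ 2 <= (e / 2) ^+ 2.
  exact: le_trans (normc_sqr_le_sqsum _ (ltnSn k)) h.
have e2 : 0 <= e / 2 by rewrite divr_ge0 ?(ltW e0).
by rewrite ler_pXn2r ?nnegrE ?normc_ge0// => h2; lra.
Qed.

(** The inequality of arithmetic and geometric means, with a free weight s.  It
replaces the Cauchy-Schwarz inequality when one factor is small and the other
one is bounded. *)
Lemma normc_sum_mul (I : Type) (r : seq I) (u v : I -> R[i]) (s : R) : 0 < s ->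
  normc (\sum_(k <- r) u k * v k) <=
  s * (\sum_(k <- r) normc (u k) ^+ 2) + s^-1 * (\sum_(k <- r) normc (v k) ^+ 2).
Proof.
move=> s0; elim: r => [|k r IH].
  by rewrite !big_nil normc0 !mulr0 addr0.
rewrite !big_cons; apply: le_trans (le_normcD _ _) _.
rewrite !mulrDr addrACA lerD//.
rewrite normcM; set a := normc _; set b := normc _.
have : 0 <= s^-1 * (s * a - b) ^+ 2 by rewrite mulr_ge0 ?sqr_ge0// invr_ge0 ltW.
have -> : s^-1 * (s * a - b) ^+ 2 = s * a ^+ 2 + s^-1 * b ^+ 2 - 2 * (a * b).
  by field; rewrite gt_eqF.
by have : 0 <= a * b by [rewrite mulr_ge0 ?normc_ge0]; lra.
Qed.

End SquareSummableSequences.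

(** * Density of trigonometric polynomials *)

Section SquareIntegrable.
Variable R : realType.
Implicit Types (f g p : R -> R).
Local Notation mu := (@lebesgue_measure R).
Local Notation D := (@angles R).

Lemma measurable_angles : measurable (D : set (measurableTypeR R)).
Proof. exact: measurable_itv. Qed.

Lemma mu_angles : mu D = (2 * pi)%:E.
Proof.
rewrite /angles lebesgue_measure_itv/= lte_fin mulr_gt0 ?pi_gt0//.
by rewrite oppr0 adde0.
Qed.

Definition intble f := mu.-integrable D (EFin \o f).

Lemma intble_measurable f : intble f -> measurable_fun D f.
Proof. by case/integrableP => /measurable_EFinP. Qed.

Lemma intbleD f g : intble f -> intble g -> intble (fun x => f x + g x).
Proof. exact: (integrableD measurable_angles). Qed.

Lemma intbleB f g : intble f -> intble g -> intble (fun x => f x - g x).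
Proof. exact: (integrableB measurable_angles). Qed.

Lemma intbleZ a f : intble f -> intble (fun x => a * f x).
Proof. exact: (integrableZl measurable_angles). Qed.

Lemma intble_le f g : measurable_fun D f ->
  (forall x, D x -> `|f x| <= g x) -> intble g -> intble f.
Proof.
move=> mf fg; apply: (le_integrable measurable_angles) => [|x Dx].
  exact/measurable_EFinP.
by rewrite /= lee_fin (le_trans (fg _ Dx))// ler_norm.
Qed.

Lemma intble_bounded f (M : R) : measurable_fun D f ->
  (forall x, D x -> `|f x| <= M) -> intble f.
Proof.
move=> mf fM; apply: (measurable_bounded_integrable measurable_angles) => //.
  by apply: (@le_lt_trans _ _ (2 * pi)%:E); rewrite ?ltry// -mu_angles.
exists M; split; first by rewrite num_real.
by move=> N MN x Dx; apply: le_trans (fM x Dx) _; exact: ltW.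
Qed.

Lemma intble_cst (M : R) : intble (fun=> M).
Proof. by apply: (@intble_bounded _ `|M|) => //; exact: measurable_cst. Qed.

Definition sqint f := measurable_fun D f /\ intble (fun x => f x ^+ 2).

Lemma sqint_le f g : measurable_fun D f ->
  (forall x, D x -> f x ^+ 2 <= g x) -> intble g -> sqint f.
Proof.
move=> mf fg ig; split=> //; apply: intble_le ig.
  exact: measurable_funX.
by move=> x Dx; rewrite ger0_norm ?sqr_ge0// fg.
Qed.

Lemma sqint_mul f g : sqint f -> sqint g -> intble (fun x => f x * g x).
Proof.
move=> [mf f2] [mg g2]; apply: intble_le (intbleD f2 g2).
  exact: measurable_funM.
move=> x _; rewrite ler_norml; apply/andP; split; nra.
Qed.

Lemma sqint_bounded f (M : R) : measurable_fun D f ->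
  (forall x, D x -> `|f x| <= M) -> sqint f.
Proof.
move=> mf fM; apply: (sqint_le mf _ (intble_cst (M ^+ 2))) => x Dx.
by rewrite -[f x ^+ 2]ger0_norm ?sqr_ge0// normrX lerXn2r ?nnegrE ?fM// (le_trans _ (fM _ Dx)).
Qed.

Lemma sqint_cst (M : R) : sqint (fun=> M).
Proof. by apply: (@sqint_bounded _ `|M|) => //; exact: measurable_cst. Qed.

Lemma sqint_intble f : sqint f -> intble f.
Proof.
by move=> /sqint_mul/(_ (sqint_cst 1)); under eq_fun do rewrite mulr1.
Qed.

Lemma sqintD f g : sqint f -> sqint g -> sqint (fun x => f x + g x).
Proof.
move=> [mf f2] [mg g2].
apply: sqint_le (intbleZ 2 (intbleD f2 g2)); first exact: measurable_funD.
move=> x _; have := sqr_ge0 (f x - g x); nra.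
Qed.

Lemma sqintZ a f : sqint f -> sqint (fun x => a * f x).
Proof.
move=> [mf f2]; apply: sqint_le (intbleZ (a ^+ 2) f2).
  by apply: measurable_funM => //; exact: measurable_cst.
by move=> x _; rewrite exprMn.
Qed.

Lemma sqintB f g : sqint f -> sqint g -> sqint (fun x => f x - g x).
Proof.
move=> sf sg; have := sqintD sf (sqintZ (-1) sg).
by under eq_fun do rewrite mulN1r.
Qed.

End SquareIntegrable.

Section ApproximableFunctions.
Variable R : realType.
Implicit Types (f g p : R -> R).
Local Notation mu := (@lebesgue_measure R).
Local Notation D := (@angles R).

Definition dint f : R := Rintegral mu D f.

Lemma dintD f g : intble f -> intble g ->
  dint (fun x => f x + g x) = dint f + dint g.
Proof. exact: (RintegralD (mu:=mu) (@measurable_angles R)). Qed.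

Lemma dintB f g : intble f -> intble g ->
  dint (fun x => f x - g x) = dint f - dint g.
Proof. exact: (RintegralB (mu:=mu) (@measurable_angles R)). Qed.

Lemma dintZ a f : intble f -> dint (fun x => a * f x) = a * dint f.
Proof. exact: (RintegralZl (mu:=mu) _ (@measurable_angles R)). Qed.

Lemma dint_le f g : intble f -> intble g -> (forall x, D x -> f x <= g x) ->
  dint f <= dint g.
Proof. exact: (le_Rintegral (mu:=mu) (@measurable_angles R)). Qed.

Lemma dint_ge0 f : (forall x, D x -> 0 <= f x) -> 0 <= dint f.
Proof. exact: (Rintegral_ge0 mu). Qed.

Lemma dint_eq f g : (forall x, D x -> f x = g x) -> dint f = dint g.
Proof. by move=> fg; apply: (eq_Rintegral mu) => x; rewrite inE; exact: fg. Qed.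

Lemma dint_cst a : dint (fun=> a) = a * (2 * pi).
Proof.
rewrite /dint (Rintegral_cst mu (@measurable_angles R)); congr (_ * _).
exact: (congr1 fine (@mu_angles R)).
Qed.

(** Both endpoints of the interval represent the point 1 of the circle, so
pointwise limits of periodic functions are only controlled in the interior. *)
Lemma ae_interior (P : R -> Prop) :
  (forall x : R, 0 < x < 2 * pi -> P x) -> {ae mu, forall x, D x -> P x}.
Proof.
move=> HP; exists ([set 0] `|` [set 2 * pi]); split.
- exact: measurableU.
- by apply: null_set_setU => //; exact: lebesgue_measure_set1.
move=> x /= /not_implyP[]; rewrite /angles /= in_itv/= => /andP[x0 x1] nP.
have [->|xn0] := eqVneq x 0; first by left.
have [->|xn1] := eqVneq x (2 * pi); first by right.
by exfalso; apply/nP/HP; rewrite !lt_neqAle x0 x1 xn1 eq_sym xn0.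
Qed.

Lemma dint_dominated (F : nat -> R -> R) g :
  (forall n, measurable_fun D (F n)) -> intble g ->
  (forall n x, D x -> 0 <= F n x <= g x) ->
  (forall x : R, 0 < x < 2 * pi -> F ^~ x @ \oo --> (0 : R)) ->
  forall e : R, 0 < e -> exists n, dint (F n) < e.
Proof.
move=> mF ig Fg F0 e e0.
have [] := @dominated_convergence _ _ _ mu _ (@measurable_angles R)
  (fun n x => (F n x)%:E) (cst 0%E) (EFin \o g).
- by move=> n; apply/measurable_EFinP; apply: mF.
- exact: measurable_cst.
- by apply: ae_interior => x /F0 Fx; apply: cvg_EFin => //; exact: nearW.
- exact: ig.
- apply: aeW => x n Dx /=; rewrite lee_fin ger0_norm; by case/andP: (Fg n x Dx).
move=> _ _; rewrite integral0 => /fine_cvgP[_] /cvgrPdist_lt/(_ _ e0)[n _ nP].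
exists n; have /= := nP n (leqnn n); rewrite sub0r normrN.
exact: le_lt_trans (ler_norm _).
Qed.

(** Polynomials in cosine and sine, for which closure under products is
immediate; [trigpoly_trig_sum] turns them into sums of exponentials. *)
Inductive trigpoly : (R -> R) -> Prop :=
| trigpoly_cst a : trigpoly (fun=> a)
| trigpoly_cos : trigpoly (@cos R)
| trigpoly_sin : trigpoly (@sin R)
| trigpolyD p q : trigpoly p -> trigpoly q -> trigpoly (fun x => p x + q x)
| trigpolyM p q : trigpoly p -> trigpoly q -> trigpoly (fun x => p x * q x).

Lemma trigpolyB p q : trigpoly p -> trigpoly q -> trigpoly (fun x => p x - q x).
Proof.
move=> tp tq; have := trigpolyD tp (trigpolyM (trigpoly_cst (-1)) tq).
by under eq_fun do rewrite mulN1r.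
Qed.

Lemma trigpolyX p n : trigpoly p -> trigpoly (fun x => p x ^+ n).
Proof.
move=> tp; elim: n => [|n IH].
  by under eq_fun do rewrite expr0; exact: trigpoly_cst.
by under eq_fun do rewrite exprS; exact: trigpolyM.
Qed.

Lemma trigpoly_measurable p : trigpoly p -> measurable_fun D p.
Proof.
elim => [a|||p1 p2 _ m1 _ m2|p1 p2 _ m1 _ m2].
- exact: measurable_cst.
- by apply: measurable_funTS; apply: continuous_measurable_fun; exact: continuous_cos.
- by apply: measurable_funTS; apply: continuous_measurable_fun; exact: continuous_sin.
- exact: measurable_funD.
- exact: measurable_funM.
Qed.

Lemma trigpoly_bounded p : trigpoly p -> exists M : R, forall x, `|p x| <= M.
Proof.
elim => [a|||p1 p2 _ [M1 h1] _ [M2 h2]|p1 p2 _ [M1 h1] _ [M2 h2]].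
- by exists `|a|.
- by exists 1 => x; exact: cos_max.
- by exists 1 => x; exact: sin_max.
- by exists (M1 + M2) => x; rewrite (le_trans (ler_normD _ _))// lerD.
- by exists (M1 * M2) => x; rewrite normrM ler_pM.
Qed.

Lemma trigpoly_sqint p : trigpoly p -> sqint p.
Proof.
move=> tp; have [M pM] := trigpoly_bounded tp.
by apply: (sqint_bounded (trigpoly_measurable tp)) => x _; exact: pM.
Qed.

(** The L2 closure of the trigonometric polynomials. *)
Definition approximable f := sqint f /\
  forall e : R, 0 < e ->
    exists2 p, trigpoly p & dint (fun x => (f x - p x) ^+ 2) < e.

Lemma trigpoly_approximable p : trigpoly p -> approximable p.
Proof.
move=> tp; split; first exact: trigpoly_sqint.
move=> e e0; exists p => //; rewrite (@dint_eq _ (fun=> 0)) ?dint_cst ?mul0r//.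
by move=> x _; rewrite subrr expr0n.
Qed.

Lemma dint_sqrD f g : sqint f -> sqint g ->
  dint (fun x => (f x + g x) ^+ 2) <=
  2 * (dint (fun x => f x ^+ 2) + dint (fun x => g x ^+ 2)).
Proof.
move=> sf sg; have [_ i2] := sqintD sf sg; have [[_ f2] [_ g2]] := (sf, sg).
rewrite -dintD// -dintZ; last exact: intbleD.
apply: dint_le => //; first exact/intbleZ/intbleD.
move=> x _; have := sqr_ge0 (f x - g x); nra.
Qed.

Lemma approximableD f g : approximable f -> approximable g ->
  approximable (fun x => f x + g x).
Proof.
move=> [sf af] [sg ag]; split; first exact: sqintD.
move=> e e0; have e4 : 0 < e / 4 by rewrite divr_gt0.
have [[p tp fp] [q tq gq]] := (af _ e4, ag _ e4).
exists (fun x => p x + q x); first exact: trigpolyD.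
rewrite (@dint_eq _ (fun x => ((f x - p x) + (g x - q x)) ^+ 2)); last first.
  by move=> x _; congr (_ ^+ 2); ring.
apply: le_lt_trans (dint_sqrD _ _) _.
- exact/sqintB/trigpoly_sqint.
- exact/sqintB/trigpoly_sqint.
- lra.
Qed.

Lemma approximableZ a f : approximable f -> approximable (fun x => a * f x).
Proof.
move=> [sf af]; split; first exact: sqintZ.
move=> e e0; have a1 : 0 < a ^+ 2 + 1 by rewrite ltr_wpDl ?sqr_ge0.
have [|p tp fp] := af (e / (a ^+ 2 + 1)); first by rewrite divr_gt0.
exists (fun x => a * p x); first exact/trigpolyM/tp/trigpoly_cst.
rewrite (@dint_eq _ (fun x => a ^+ 2 * (f x - p x) ^+ 2)); last first.
  by move=> x _; rewrite -exprMn mulrBr.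
rewrite dintZ; last by have [] := sqintB sf (trigpoly_sqint tp).
move: fp; rewrite ltr_pdivlMr//; set d := dint _ => fp.
have d0 : 0 <= d by apply: dint_ge0 => x _; exact: sqr_ge0.
nra.
Qed.

Lemma approximableB f g : approximable f -> approximable g ->
  approximable (fun x => f x - g x).
Proof.
move=> af ag; have := approximableD af (approximableZ (-1) ag).
by under eq_fun do rewrite mulN1r.
Qed.

Lemma approximable_sum (I : Type) (s : seq I) (F : I -> R -> R) :
  (forall i, approximable (F i)) -> approximable (fun x => \sum_(i <- s) F i x).
Proof.
move=> aF; elim: s => [|i s IH].
  by under eq_fun do rewrite big_nil; exact/trigpoly_approximable/trigpoly_cst.
by under eq_fun do rewrite big_cons; exact: approximableD.
Qed.

Lemma approximable_lim (F : nat -> R -> R) f g :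
  (forall n, approximable (F n)) -> sqint f -> intble g ->
  (forall n x, D x -> (F n x - f x) ^+ 2 <= g x) ->
  (forall x : R, 0 < x < 2 * pi -> F ^~ x @ \oo --> f x) ->
  approximable f.
Proof.
move=> aF sf ig Fg Ff; split=> // e e0; have e4 : 0 < e / 4 by rewrite divr_gt0.
have [n Fn] : exists n, dint (fun x => (F n x - f x) ^+ 2) < e / 4.
  apply: (dint_dominated (F := fun n x => (F n x - f x) ^+ 2) _ ig) => //.
  - move=> n; apply: measurable_funX; apply: measurable_funB.
      by have [[]] := aF n.
    by case: sf.
  - by move=> n x Dx; rewrite sqr_ge0 Fg.
  - move=> x xD.
    have /cvgB/(_ (cvg_cst (f x))) := Ff x xD; rewrite subrr => h.
    have := cvgM h h; rewrite mulr0 => hh; under eq_fun do rewrite expr2.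
    exact: hh.
have [sFn /(_ _ e4)[p tp Fp]] := aF n; exists p => //.
rewrite (@dint_eq _ (fun x => ((F n x - p x) + (-1) * (F n x - f x)) ^+ 2)); last first.
  by move=> x _; congr (_ ^+ 2); ring.
have sB := sqintB sFn sf.
apply: le_lt_trans (dint_sqrD _ _) _.
- exact/sqintB/trigpoly_sqint.
- exact: sqintZ.
- under [X in 2 * (_ + X)]dint_eq do rewrite mulN1r sqrrN.
  lra.
Qed.

End ApproximableFunctions.

Section Step.
Variable R : realType.
Implicit Types (x y : R) (n k : nat).

Lemma bernoulli_le x k : 0 <= x <= 1 -> 1 - k%:R * x <= (1 - x) ^+ k.
Proof.
move=> /andP[x0 x1]; elim: k => [|k IH]; first by rewrite expr0 mul0r subr0.
rewrite exprS -natr1; have := @ler0n R k; nra.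
Qed.

(** (1 - x)^k <= (1 + x)^-k, and (1 + x)^k >= 1 + k x. *)
Lemma bernoulli_inv x k : 0 <= x <= 1 -> (1 - x) ^+ k * (1 + k%:R * x) <= 1.
Proof.
move=> /andP[x0 x1]; elim: k => [|k IH]; first by rewrite expr0 mul0r addr0 mulr1.
apply: le_trans IH; rewrite exprSr -mulrA ler_wpM2l ?exprn_ge0 ?subr_ge0//.
by rewrite -natr1; have := @ler0n R k; nra.
Qed.

(** On [0, 1] these polynomials converge to the indicator of y < 1 / 2.  With the
exponent 2 ^ n alone, the value at y = 1 / 2 would tend to exp (-1) instead
of 0. *)
Definition step_poly n y : R := (1 - y ^+ n) ^+ (n * 2 ^ n).

Lemma step_poly_itv n y : 0 <= y <= 1 -> 0 <= step_poly n y <= 1.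
Proof.
move=> /andP[y0 y1]; have yn0 := exprn_ge0 n y0; have yn1 := exprn_ile1 n y0 y1.
by rewrite /step_poly exprn_ge0 ?subr_ge0// exprn_ile1 ?subr_ge0// gerBl.
Qed.

Lemma cvg_step_poly0 y : 1 / 2 <= y <= 1 -> step_poly ^~ y @ \oo --> (0 : R).
Proof.
move=> /andP[y2 y1]; have y0 : 0 <= y by lra.
apply: (@squeeze_cvgr _ _ _ _ (fun=> 0) (harmonic : nat -> R)).
- apply: nearW => n; have /andP[-> _]/= : 0 <= step_poly n y <= 1.
    by apply: step_poly_itv; rewrite y0.
  have yn : 0 <= y ^+ n <= 1 by rewrite exprn_ge0//= exprn_ile1.
  have := bernoulli_inv (n * 2 ^ n) yn.
  rewrite -/(step_poly n y) natrM natrX -mulrA -exprMn.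
  rewrite -ler_pdivlMr; last first.
    by rewrite ltr_pwDl// mulr_ge0// exprn_ge0// mulr_ge0.
  move=> /le_trans; apply; rewrite div1r lef_pV2 ?posrE ?ltr0Sn//; last first.
    by rewrite ltr_pwDl// mulr_ge0// exprn_ge0// mulr_ge0.
  rewrite -natr1 addrC lerD2l ler_peMr// exprn_ege1//; lra.
- exact: cvg_cst.
- exact: cvg_harmonic.
Qed.

(** With s the square root of y, n s^n stays bounded by [bernoulli_inv], which
leaves a factor s^n. *)
Lemma cvg_natr_geometric y : 0 <= y < 1 -> (fun n => n%:R * y ^+ n) @ \oo --> (0 : R).
Proof.
move=> /andP[y0 y1]; pose s := Num.sqrt y.
have s0 : 0 <= s := sqrtr_ge0 _.
have s1 : s < 1 by rewrite -[1]sqrtr1 ltr_sqrt.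
apply: (@squeeze_cvgr _ _ _ _ (fun=> 0) (geometric (1 - s)^-1 s)).
- apply: nearW => n; rewrite mulr_ge0 ?exprn_ge0//=.
  rewrite -[y](sqr_sqrtr y0) -/s -exprM mul2n -addnn exprD mulrA.
  rewrite ler_wpM2r ?exprn_ge0// -div1r ler_pdivlMr ?subr_gt0//.
  have /(bernoulli_inv n) : 0 <= 1 - s <= 1 by lra.
  rewrite subKr; apply: le_trans.
  by have := exprn_ge0 n s0; nra.
- exact: cvg_cst.
- by apply: cvg_geometric; rewrite ger0_norm.
Qed.

Lemma cvg_step_poly1 y : 0 <= y < 1 / 2 -> step_poly ^~ y @ \oo --> (1 : R).
Proof.
move=> /andP[y0 y2]; have y1 : y <= 1 by lra.
apply: (@squeeze_cvgr _ _ _ _ (fun n => 1 - n%:R * (2 * y) ^+ n) (fun=> 1)).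
- apply: nearW => n; have /andP[_ ->] : 0 <= step_poly n y <= 1.
    by apply: step_poly_itv; rewrite y0.
  rewrite andbT; apply: le_trans (bernoulli_le _ _).
    by rewrite natrM natrX -mulrA -exprMn.
  by rewrite exprn_ge0//= exprn_ile1.
- rewrite -[X in _ --> X]subr0; apply: cvgB; first exact: cvg_cst.
  apply: cvg_natr_geometric; lra.
- exact: cvg_cst.
Qed.

End Step.

Section DensityOfTrigonometricPolynomials.
Import HBNNSimple.
Variable R : realType.
Implicit Types (f g p : R -> R).
Local Notation mu := (@lebesgue_measure R).
Local Notation D := (@angles R).

Lemma approximable_bounded_lim (F : nat -> R -> R) f (M : R) :
  (forall n, approximable (F n)) -> measurable_fun D f ->
  (forall n x, D x -> `|F n x| <= M) -> (forall x, D x -> `|f x| <= M) ->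
  (forall x : R, 0 < x < 2 * pi -> F ^~ x @ \oo --> f x) ->
  approximable f.
Proof.
move=> aF mf FM fM Ff; apply: (approximable_lim aF _ (intble_cst ((M + M) ^+ 2))) Ff.
  exact: sqint_bounded fM.
move=> n x Dx; rewrite -[X in X <= _]ger0_norm ?sqr_ge0// normrX.
have M0 : 0 <= M := le_trans (normr_ge0 _) (fM _ Dx).
rewrite lerXn2r ?nnegrE ?addr_ge0// (le_trans (ler_normB _ _))// lerD//.
  exact: FM.
exact: fM.
Qed.

(** For 0 <= a < 2 pi, a trigonometric polynomial whose values in ]0, 2 pi[ are
below 1 / 2 exactly to the right of a is composed with [step_poly]. *)
(** Dynkin's lemma for the pi-system of rays; bounded limits of approximable
functions are approximable, which handles countable disjoint unions. *)
Lemma approximable_indic_ray (a : R) : approximable (\1_(`]a, +oo[ : set R) : R -> R).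
Proof.
have m1 (b : R) : measurable_fun D (\1_(`]b, +oo[ : set R) : R -> R).
  by apply: measurable_indic; exact: measurable_itv.
have n1 (b x : R) : D x -> `|(\1_(`]b, +oo[ : set R) : R -> R) x| <= 1.
  by move=> _; rewrite indicE ger0_norm//; case: (_ \in _).
have [a0|a0] := ltP a 0.
  apply: (@approximable_bounded_lim (fun _ _ => 1) _ 1) => //.
  - by move=> _; exact/trigpoly_approximable/trigpoly_cst.
  - by move=> n x _; rewrite normr1.
  - exact: n1.
  - move=> x /andP[x0 _]; rewrite indicE mem_set; first exact: cvg_cst.
    by rewrite /= in_itv/= (lt_trans a0).
have [a2|a2] := leP (2 * pi) a.
  apply: (@approximable_bounded_lim (fun _ _ => 0) _ 1) => //.
  - by move=> _; exact/trigpoly_approximable/trigpoly_cst.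
  - by move=> n x _; rewrite normr0.
  - exact: n1.
  - move=> x /andP[_ x2]; rewrite indicE memNset; first exact: cvg_cst.
    by rewrite /= in_itv/= andbT; apply/negP; rewrite -leNgt (le_trans (ltW x2)).
(* The product formula [yE] below shows the sign of y - 1 / 2: sin (x / 2) is
   positive inside the interval, and sin ((x - a) / 2) changes sign at a. *)
pose y x : R := 1 / 2 + (cos (x - a / 2) - cos (a / 2)) / 4.
have y01 x : 0 <= y x <= 1.
  have [] := (cos_le1 (x - a / 2), cos_geN1 (x - a / 2)).
  have [] := (cos_le1 (a / 2), cos_geN1 (a / 2)).
  by rewrite /y; move=> h1 h2 h3 h4; apply/andP; split; lra.
have yE x : y x = 1 / 2 - sin (x / 2) * sin ((x - a) / 2) / 2.
  rewrite /y; have -> : x - a / 2 = x / 2 + (x - a) / 2 by lra.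
  have -> : a / 2 = x / 2 - (x - a) / 2 by lra.
  by rewrite cosD cosB; lra.
have ty : trigpoly y.
  apply: trigpolyD; first exact: trigpoly_cst.
  have -> : (fun x => (cos (x - a / 2) - cos (a / 2)) / 4) =
     (fun x => (1 / 4 * cos (a / 2)) * cos x + ((1 / 4 * sin (a / 2)) * sin x
               + - (cos (a / 2) / 4))).
    by apply: funext => x; rewrite cosB; lra.
  by do ![exact: trigpoly_cst|exact: trigpoly_cos|exact: trigpoly_sin
         |apply: trigpolyD|apply: trigpolyM].
apply: (@approximable_bounded_lim (fun n x => step_poly n (y x)) _ 1) => //.
- move=> n; apply: trigpoly_approximable; apply: trigpolyX.
  by apply: trigpolyB; [exact: trigpoly_cst|exact: trigpolyX].
- by move=> n x _; have /andP[h0 h1] := step_poly_itv n (y01 x); rewrite ger0_norm.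
- exact: n1.
- move=> x /andP[x0 x2]; have sx : 0 < sin (x / 2).
    by apply: sin_gt0_pi; apply/andP; split; lra.
  have /andP[y0 y1] := y01 x.
  rewrite indicE; have [ax|xa] := ltP a x.
    rewrite mem_set; last by rewrite /= in_itv/= ax.
    apply: cvg_step_poly1; rewrite y0 yE/=.
    have sa : 0 < sin ((x - a) / 2).
      by apply: sin_gt0_pi; apply/andP; split; lra.
    by have := mulr_gt0 sx sa; lra.
  rewrite memNset; last by rewrite /= in_itv/= andbT; apply/negP; rewrite -leNgt.
  apply: cvg_step_poly0; rewrite y1 andbT yE.
  have sa : 0 <= sin ((a - x) / 2).
    by apply: sin_ge0_pi; apply/andP; split; lra.
  have -> : (x - a) / 2 = - ((a - x) / 2) by lra.
  by rewrite sinN; have := mulr_ge0 (ltW sx) sa; lra.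
Qed.

(** Dynkin's lemma for the pi-system of rays; bounded limits of approximable
functions are approximable, which handles countable disjoint unions. *)
Lemma approximable_indic (A : set (measurableTypeR R)) :
  measurable A -> approximable (\1_A : R -> R).
Proof.
have mE : @measurable _ (measurableTypeR R) = <<s @RGenOInfty.G R >>.
  exact: RGenOInfty.measurableE.
move=> mA; have : <<s @RGenOInfty.G R >> A by rewrite -mE.
move: A mA => A _.
apply: (@dynkin_induction _ (measurableTypeR R) (@RGenOInfty.G R)
  (fun A => approximable (\1_A : R -> R))) => //.
- move=> _ _ [x ->] [y ->]; exists (Num.max x y).
  by apply/seteqP; split=> z /=; rewrite !in_itv/= !andbT gt_max => /andP.
- by rewrite indicT; exact/trigpoly_approximable/trigpoly_cst.
- by move=> _ [x ->]; exact: approximable_indic_ray.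
- move=> S mS aS; rewrite (_ : \1_(~` S) = (fun x => 1 - \1_S x) :> (R -> R)).
    by apply: approximableB => //; exact/trigpoly_approximable/trigpoly_cst.
  by apply: funext => x; rewrite !indicE in_setC; case: (x \in S); rewrite ?subrr ?subr0.
- move=> F mF tF aF.
  (* As the sets are disjoint, the partial sums at x jump once from 0 to 1. *)
  have sumF n x k : F k x -> \sum_(i <- iota 0 n) (\1_(F i) : R -> R) x = (k < n)%N%:R.
    move=> Fkx; have Fi i : i != k -> (\1_(F i) : R -> R) x = 0.
      move=> ik; rewrite indicE memNset// => Fix.
      by move/eqP: ik; apply; apply: (tF i k) => //; exists x.
    have [kn|nk] := ltnP k n.
      rewrite (bigD1_seq k)/= ?iota_uniq ?mem_iota//= big1 ?addr0//.
      by rewrite indicE mem_set.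
    rewrite big_seq big1// => i; rewrite mem_iota/= add0n => iN.
    by apply: Fi; apply: contraTneq iN => ->; rewrite -leqNgt.
  apply: (@approximable_bounded_lim
    (fun n x => \sum_(i <- iota 0 n) (\1_(F i) : R -> R) x) _ 1) => //.
  - by move=> n; exact: approximable_sum.
  - by apply: measurable_indic; apply: bigcup_measurable => k _; exact: mF.
  - move=> n x _; have [[k Fkx]|nF] := pselect (exists k, F k x).
      by rewrite (sumF _ _ _ Fkx); case: (k < n)%N; rewrite ?normr1 ?normr0.
    rewrite big1 ?normr0// => i _; rewrite indicE memNset// => Fi.
    by apply: nF; exists i.
  - by move=> x _; rewrite indicE; case: (_ \in _); rewrite ?normr1 ?normr0.
  - move=> x _; have [[k Fkx]|nF] := pselect (exists k, F k x).
      rewrite indicE mem_set; last by exists k.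
      apply: cvg_near_cst; exists k.+1 => // n /= kn.
      by rewrite (sumF _ _ _ Fkx) kn.
    rewrite indicE memNset; last by move=> [k _ Fk]; apply: nF; exists k.
    apply: cvg_near_cst; apply: nearW => n.
    rewrite big1// => i _; rewrite indicE memNset// => Fi.
    by apply: nF; exists i.
Qed.

(** A nonnegative f is the limit of simple functions below f, and the squared
errors are dominated by the square of f. *)
Lemma sqint_approximable f : sqint f -> approximable f.
Proof.
have pos g : (forall x, 0 <= g x) -> sqint g -> approximable g.
  move=> g0 sg; have [mg ig] := sg.
  have mg' : measurable_fun D (EFin \o g) by exact/measurable_EFinP.
  pose h := nnsfun_approx (@measurable_angles R) mg'.
  have g0' x : D x -> (0 <= (EFin \o g) x)%E by move=> _; rewrite lee_fin.
  apply: (@approximable_lim R (fun n => (h n : R -> R)) g (fun x => g x ^+ 2)) => //.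
  - move=> n; rewrite (funext (fimfunEord (h n))).
    apply: approximable_sum => i; apply: approximableZ; apply: approximable_indic.
    exact: measurable_funPTI.
  - move=> n x Dx; have h0 : 0 <= h n x by [].
    have : ((h n x)%:E <= (g x)%:E)%E.
      by rewrite /h nnsfun_approxE; exact: le_approx.
    rewrite lee_fin => hg; have := g0 x; nra.
  - move=> x /andP[x0 x2].
    have : EFin \o h^~ x @ \oo --> (EFin \o g) x.
      by apply: cvg_nnsfun_approx => //; rewrite /angles/= in_itv/= !ltW.
    by move=> /fine_cvgP[].
move=> sf; have [mf if2] := sf.
rewrite (_ : f = (fun x => f^\+ x - f^\- x)); last first.
  by apply/funext => x; rewrite -[LHS](congr1 (@^~ x) (funrposBneg f)).
apply: approximableB; apply: pos.
- exact: funrpos_ge0.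
- apply: (sqint_le _ _ if2); first exact: measurable_funrpos.
  by move=> x _; rewrite /funrpos; case: (leP (f x) 0) => _; rewrite ?expr0n ?sqr_ge0// lexx.
- exact: funrneg_ge0.
- apply: (sqint_le _ _ if2); first exact: measurable_funrneg.
  by move=> x _; rewrite /funrneg; case: (leP (- f x) 0) => _; rewrite ?expr0n ?sqr_ge0// sqrrN lexx.
Qed.

End DensityOfTrigonometricPolynomials.

(** * Integrals and Fourier coefficients of complex functions *)

Section ComplexIntegral.
Local Open Scope complex_scope.
Variable R : realType.
Implicit Types (F G : R -> R[i]).
Local Notation mu := (@lebesgue_measure R).
Local Notation D := (@angles R).
Local Notation Re := complex.Re.
Local Notation Im := complex.Im.

Definition cintble F := intble (fun t => Re (F t)) /\ intble (fun t => Im (F t)).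

Definition cint F : R[i] :=
  dint (fun t => Re (F t)) +i* dint (fun t => Im (F t)).

Lemma cintbleD F G : cintble F -> cintble G -> cintble (fun t => F t + G t).
Proof.
move=> [rF iF] [rG iG]; split.
  by under eq_fun do rewrite cReD; exact: intbleD.
by under eq_fun do rewrite cImD; exact: intbleD.
Qed.

Lemma cintD F G : cintble F -> cintble G ->
  cint (fun t => F t + G t) = cint F + cint G.
Proof.
move=> [rF iF] [rG iG]; apply: eq_complexP; rewrite ?cReD ?cImD /cint /= -dintD//.
  by apply: dint_eq => x _; rewrite cReD.
by apply: dint_eq => x _; rewrite cImD.
Qed.

Lemma cintbleZ a F : cintble F -> cintble (fun t => a * F t).
Proof.
move=> [rF iF]; split.
  by under eq_fun do rewrite cReM; apply: intbleB; exact: intbleZ.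
by under eq_fun do rewrite cImM; apply: intbleD; exact: intbleZ.
Qed.

Lemma cintZ a F : cintble F -> cint (fun t => a * F t) = a * cint F.
Proof.
move=> [rF iF]; apply: eq_complexP; rewrite ?cReM ?cImM /cint /=.
  rewrite -!dintZ// -dintB; [|exact: intbleZ|exact: intbleZ].
  by apply: dint_eq => x _; rewrite cReM.
rewrite -!dintZ// -dintD; [|exact: intbleZ|exact: intbleZ].
by apply: dint_eq => x _; rewrite cImM.
Qed.

Lemma cint0 : cint (fun=> 0) = 0.
Proof. by rewrite /cint /= !dint_cst !mul0r. Qed.

Lemma cintble0 : cintble (fun=> 0).
Proof. by split; exact: intble_cst. Qed.

Lemma cintble_sum (I : Type) (s : seq I) (F : I -> R -> R[i]) :
  (forall i, cintble (F i)) -> cintble (fun t => \sum_(i <- s) F i t).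
Proof.
move=> iF; elim: s => [|i s IH].
  by under eq_fun do rewrite big_nil; exact: cintble0.
by under eq_fun do rewrite big_cons; exact: cintbleD.
Qed.

Lemma cint_sum (I : Type) (s : seq I) (F : I -> R -> R[i]) :
  (forall i, cintble (F i)) ->
  cint (fun t => \sum_(i <- s) F i t) = \sum_(i <- s) cint (F i).
Proof.
move=> iF; elim: s => [|i s IH].
  by under eq_fun do rewrite big_nil; rewrite big_nil cint0.
under eq_fun do rewrite big_cons; rewrite cintD ?IH ?big_cons//.
exact: cintble_sum.
Qed.

Lemma cint_eq F G : (forall t, D t -> F t = G t) -> cint F = cint G.
Proof.
by move=> FG; rewrite /cint; congr (_ +i* _); apply: dint_eq => t Dt; rewrite FG.
Qed.

Lemma cint_conj F : cintble F -> cint (fun t => conjc (F t)) = conjc (cint F).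
Proof.
move=> [rF iF]; apply: eq_complexP; rewrite ?cReJ ?cImJ /cint/=.
  by apply: dint_eq => t _; rewrite cReJ.
rewrite -mulN1r -dintZ//; apply: dint_eq => t _; by rewrite cImJ mulN1r.
Qed.

(** Componentwise, so that the real theory applies to both components. *)
Definition L2 F := sqint (fun t => Re (F t)) /\ sqint (fun t => Im (F t)).

Lemma L2D F G : L2 F -> L2 G -> L2 (fun t => F t + G t).
Proof.
move=> [rF iF] [rG iG]; split.
  by under eq_fun do rewrite cReD; exact: sqintD.
by under eq_fun do rewrite cImD; exact: sqintD.
Qed.

Lemma L2Z a F : L2 F -> L2 (fun t => a * F t).
Proof.
move=> [rF iF]; split.
  by under eq_fun do rewrite cReM; apply: sqintB; exact: sqintZ.
by under eq_fun do rewrite cImM; apply: sqintD; exact: sqintZ.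
Qed.

Lemma L2B F G : L2 F -> L2 G -> L2 (fun t => F t - G t).
Proof.
by move=> lF /(L2Z (-1))/(L2D lF); under eq_fun do rewrite mulN1r.
Qed.

Lemma L2_conj F : L2 F -> L2 (fun t => conjc (F t)).
Proof.
move=> [rF iF]; split; first by under eq_fun do rewrite cReJ.
by under eq_fun do rewrite cImJ -mulN1r; exact: sqintZ.
Qed.

Lemma L2_cst a : L2 (fun=> a).
Proof. by split; exact: sqint_cst. Qed.

Lemma L2_sum (I : Type) (s : seq I) (F : I -> R -> R[i]) :
  (forall i, L2 (F i)) -> L2 (fun t => \sum_(i <- s) F i t).
Proof.
move=> iF; elim: s => [|i s IH].
  by under eq_fun do rewrite big_nil; exact: L2_cst.
by under eq_fun do rewrite big_cons; exact: L2D.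
Qed.

Lemma L2_mul F G : L2 F -> L2 G -> cintble (fun t => F t * G t).
Proof.
move=> [rF iF] [rG iG]; split.
  by under eq_fun do rewrite cReM; apply: intbleB; exact: sqint_mul.
by under eq_fun do rewrite cImM; apply: intbleD; exact: sqint_mul.
Qed.

Lemma L2_intble F : L2 F -> cintble F.
Proof. by move=> [? ?]; split; exact: sqint_intble. Qed.

Lemma measurable_trig (k : int) :
  measurable_fun D (fun t : R => cos (k%:~R * t)) /\
  measurable_fun D (fun t : R => sin (k%:~R * t)).
Proof.
have mk : measurable_fun D (fun t : R => k%:~R * t).
  by apply: measurable_funTS; exact: mulrl_measurable.
by split; apply: measurableT_comp mk; apply: continuous_measurable_fun;
  [exact: continuous_cos|exact: continuous_sin].
Qed.

Lemma L2_expz k : L2 (expz k).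
Proof.
have [mc ms] := measurable_trig k; split.
  by apply: (sqint_bounded mc) => t _; exact: cos_max.
by apply: (sqint_bounded ms) => t _; exact: sin_max.
Qed.

Lemma L2_expzM k F : L2 F -> L2 (fun t => expz k t * F t).
Proof.
have [mc ms] := measurable_trig k.
have H (u v : R -> R) : measurable_fun D u -> (forall t, `|u t| <= 1) ->
    sqint v -> sqint (fun t => u t * v t).
  move=> mu u1 [mv iv]; apply: (sqint_le _ _ iv); first exact: measurable_funM.
  move=> t _; rewrite exprMn ler_piMl ?sqr_ge0//.
  by rewrite -[_ ^+ 2]ger0_norm ?sqr_ge0// normrX exprn_ile1.
move=> [rF iF]; split.
  under eq_fun do rewrite cReM; apply: sqintB; apply: H => //= t;
    [exact: cos_max|exact: sin_max].
under eq_fun do rewrite cImM; apply: sqintD; apply: H => //= t;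
  [exact: cos_max|exact: sin_max].
Qed.

(** The fundamental theorem of calculus, with a periodic primitive. *)
Lemma cint_expz k : cint (expz k) = if k == 0 then (2 * pi)%:C else 0.
Proof.
have [->|k0] := eqVneq k 0.
  rewrite (@cint_eq _ (fun=> 1)); last by move=> t _; rewrite expz0.
  by rewrite /cint /= !dint_cst mul1r mul0r.
pose c : R := k%:~R; have c0 : c != 0 by rewrite intr_eq0.
have pi2 : (0 : R) < 2 * pi by rewrite mulr_gt0// pi_gt0.
have dlin (x : R) : is_derive x 1 (fun t : R => c * t) c.
  have := @is_deriveZ R R R id c x 1 1 (is_derive_id x 1); move=> /is_derive_eq; apply; by rewrite /GRing.scale/= mulr1.
have ftc (f H : R -> R) : continuous f ->
    (forall x : R, is_derive x 1 H (f x)) -> H (2 * pi) = H 0 -> dint f = 0.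
  move=> cf dH Hper; rewrite /dint /Rintegral.
  rewrite (@continuous_FTC2 _ f H 0 (2 * pi))//.
  - by rewrite Hper -EFinB subrr.
  - exact: continuous_subspaceT.
  - have dc x : {for x, continuous H}.
      by apply: differentiable_continuous; apply/derivable1_diffP; case: (dH x).
    split.
    + by move=> x _; case: (dH x).
    + by apply: cvg_at_right_filter; exact: dc.
    + by apply: cvg_at_left_filter; exact: dc.
  - by move=> x _; rewrite derive1E; case: (dH x).
have per : sin (c * (2 * pi)) = 0 :> R /\ cos (c * (2 * pi)) = 1 :> R.
  have pern n : sin (n%:R * (2 * pi)) = 0 :> R /\ cos (n%:R * (2 * pi)) = 1 :> R.
    elim: n => [|n [IHs IHc]]; first by rewrite mul0r sin0 cos0.
    rewrite -natr1 mulrDl mul1r sinD cosD IHs IHc.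
    by rewrite mulr_natl sin2pi cos2pi; split; ring.
  rewrite /c; case: (intP k) => [|n|n].
  - by rewrite mul0r sin0 cos0.
  - exact: pern.
  - by rewrite rmorphN mulNr sinN cosN; have [-> ->] := pern n.+1; rewrite oppr0.
rewrite /cint; congr (_ +i* _).
- apply: (ftc _ (fun t => c^-1 * sin (c * t))).
  + move=> x; apply: (continuous_comp (f := fun t => c * t)).
      by apply: mulrl_continuous.
    exact: continuous_cos.
  + move=> x; have := is_derive1_comp (is_derive_sin (c * x)) (dlin x).
    move=> /(@is_deriveZ R R R _ c^-1)/is_derive_eq; apply.
    by rewrite /GRing.scale/= mulrCA mulVf// mulr1.
  + by rewrite mulr0 sin0 per.1.
- apply: (ftc _ (fun t => - (c^-1 * cos (c * t)))).
  + move=> x; apply: (continuous_comp (f := fun t => c * t)).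
      by apply: mulrl_continuous.
    exact: continuous_sin.
  + move=> x; have := is_derive1_comp (is_derive_cos (c * x)) (dlin x).
    move=> /(@is_deriveZ R R R _ (- c^-1))/is_derive_eq h.
    rewrite (_ : (fun t => _) = - c^-1 \*: (cos \o (fun t => c * t))).
      by apply: h; rewrite /GRing.scale/= mulrC -mulrA mulrN mulfV// mulrN1 opprK.
    apply: funext => t. exact: (esym (mulNr _ _)).
  + by rewrite mulr0 cos0 per.2.
Qed.

End ComplexIntegral.

Arguments expz {R} k t : simpl never.
Arguments conjc {R} x : simpl never.

Section FourierCoefficients.
Local Open Scope complex_scope.
Variable R : realType.
Implicit Types (F G : R -> R[i]) (s : seq int).
Local Notation mu := (@lebesgue_measure R).
Local Notation D := (@angles R).
Local Notation Re := complex.Re.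
Local Notation Im := complex.Im.

(** Fourier coefficients as functions of the angle; those of a function on the
circle are an instance by conversion ([fourierE]). *)
Definition coef F (k : int) : R[i] :=
  ((2 * pi)^-1)%:C * cint (fun t => F t * expi (- (k%:~R * t))).

Lemma coefE F k : coef F k = ((2 * pi)^-1)%:C * cint (fun t => F t * expz (- k) t).
Proof. by rewrite /coef; under eq_fun do rewrite expzN. Qed.

Lemma pi2_gt0 : 0 < 2 * pi :> R.
Proof. by rewrite mulr_gt0// pi_gt0. Qed.

Lemma pi2K : (2 * pi)%:C * ((2 * pi)^-1)%:C = 1 :> R[i].
Proof. by rewrite -rmorphM/= mulfV// gt_eqF// pi2_gt0. Qed.

Lemma cint_coef F k : cint (fun t => F t * conjc (expz k t)) = (2 * pi)%:C * coef F k.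
Proof.
rewrite coefE mulrA pi2K mul1r.
by apply: cint_eq => t _; rewrite expz_conj.
Qed.

Lemma L2_mulexpz F k : L2 F -> cintble (fun t => F t * expz k t).
Proof. by move=> lF; apply: L2_mul => //; exact: L2_expz. Qed.

Lemma coefD F G k : L2 F -> L2 G ->
  coef (fun t => F t + G t) k = coef F k + coef G k.
Proof.
move=> lF lG; rewrite !coefE -mulrDr -cintD; try exact: L2_mulexpz.
by under eq_fun do rewrite mulrDl.
Qed.

Lemma coefZ a F k : L2 F -> coef (fun t => a * F t) k = a * coef F k.
Proof.
move=> lF; rewrite !coefE mulrCA -(cintZ a); last exact: L2_mulexpz.
by under eq_fun do rewrite -mulrA.
Qed.

Lemma coefB F G k : L2 F -> L2 G ->
  coef (fun t => F t - G t) k = coef F k - coef G k.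
Proof.
move=> lF lG; rewrite (_ : (fun t => F t - G t) = (fun t => F t + -1 * G t)).
  by rewrite coefD ?coefZ ?mulN1r//; exact: L2Z.
by apply: funext => t; rewrite mulN1r.
Qed.

Lemma coef_sum (I : Type) (r : seq I) (F : I -> R -> R[i]) k :
  (forall i, L2 (F i)) ->
  coef (fun t => \sum_(i <- r) F i t) k = \sum_(i <- r) coef (F i) k.
Proof.
move=> lF; elim: r => [|i r IH].
  under eq_fun do rewrite big_nil.
  by rewrite big_nil /coef; under eq_fun do rewrite mul0r; rewrite cint0 mulr0.
under eq_fun do rewrite big_cons; rewrite coefD ?IH ?big_cons//.
exact: L2_sum.
Qed.

Lemma coef_expz j k : coef (expz j) k = (j == k)%:R.
Proof.
rewrite coefE; under eq_fun do rewrite -expzD.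
rewrite (_ : cint _ = if j - k == 0 then (2 * pi)%:C else 0); last exact: cint_expz.
rewrite subr_eq0; case: eqP => _; last by rewrite mulr0.
by rewrite mulrC pi2K.
Qed.

Lemma coef_conj F k : L2 F -> coef (fun t => conjc (F t)) k = conjc (coef F (- k)).
Proof.
move=> lF; rewrite !coefE opprK rmorphM/= conjc_real; congr (_ * _).
rewrite -cint_conj; last exact: L2_mulexpz.
by apply: cint_eq => t _; rewrite rmorphM/= expz_conj.
Qed.

Definition nrm2 F : R := dint (fun t => normc (F t) ^+ 2).

Lemma nrm2_intble F : L2 F -> intble (fun t => normc (F t) ^+ 2).
Proof.
by move=> [[_ rF] [_ iF]]; under eq_fun do rewrite normc_sqr; exact: intbleD.
Qed.

Lemma nrm2_ge0 F : 0 <= nrm2 F.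
Proof. by apply: dint_ge0 => t _; exact: sqr_ge0. Qed.

Lemma nrm2E F : nrm2 F = Re (cint (fun t => F t * conjc (F t))).
Proof. by rewrite /nrm2 /cint/=; apply: dint_eq => t _; rewrite mulcJ. Qed.

Lemma nrm2_pythagoras F G : L2 F -> L2 G ->
  cint (fun t => F t * conjc (G t)) = 0 ->
  nrm2 (fun t => F t + G t) = nrm2 F + nrm2 G.
Proof.
move=> lF lG FG; have iFG := L2_mul lF (L2_conj lG).
rewrite /nrm2 -dintD; try exact: nrm2_intble.
have RFG : dint (fun t => Re (F t * conjc (G t))) = 0 := congr1 (@complex.Re R) FG.
rewrite -[RHS]addr0 -[X in _ + X](mulr0 2) -[X in _ + 2 * X]RFG.
rewrite -dintZ; last by case: iFG.
rewrite -dintD; [|by apply: intbleD; exact: nrm2_intble|by apply: intbleZ; case: iFG].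
by apply: dint_eq => t _; rewrite !normc_sqr cReM cReD cImD cReJ cImJ; ring.
Qed.

(** Pairs of a coefficient and a frequency; frequencies may be repeated, so that
no regrouping is needed in sums and products. *)
Definition trig_sum (r : seq (R[i] * int)) (t : R) : R[i] :=
  \sum_(x <- r) x.1 * expz x.2 t.

Lemma L2_trig_sum r : L2 (trig_sum r).
Proof. by apply: L2_sum => x; apply: L2Z; exact: L2_expz. Qed.

Lemma cint_trig_sum F r : L2 F ->
  cint (fun t => F t * conjc (trig_sum r t)) =
  (2 * pi)%:C * \sum_(x <- r) conjc x.1 * coef F x.2.
Proof.
move=> lF; rewrite mulr_sumr.
transitivity (cint (fun t => \sum_(x <- r) conjc x.1 * (F t * conjc (expz x.2 t)))).
  apply: cint_eq => t _; rewrite rmorph_sum mulr_sumr; apply: eq_bigr => x _.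
  by rewrite rmorphM/= mulrCA.
rewrite cint_sum.
  apply: eq_bigr => x _; rewrite cintZ ?cint_coef; first by rewrite mulrCA.
  by apply: L2_mul => //; apply: L2_conj; exact: L2_expz.
move=> x; apply: cintbleZ; apply: L2_mul => //; apply: L2_conj; exact: L2_expz.
Qed.

(** The partial sum of the Fourier series over the frequencies in s. *)
Definition proj s F : R -> R[i] := trig_sum [seq (coef F k, k) | k <- s].

Lemma projE s F t : proj s F t = \sum_(k <- s) coef F k * expz k t.
Proof. by rewrite /proj /trig_sum big_map. Qed.

Lemma L2_proj s F : L2 (proj s F).
Proof. exact: L2_trig_sum. Qed.

Lemma coef_proj s F k : uniq s ->
  coef (proj s F) k = if k \in s then coef F k else 0.
Proof.
move=> us; rewrite (funext (projE s F)) coef_sum; last first.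
  by move=> j; apply: L2Z; exact: L2_expz.
under eq_bigr => j _ do rewrite (coefZ _ _ (L2_expz _ j)) coef_expz.
case: ifP => ks.
  rewrite (bigD1_seq k)//= eqxx mulr1 big1 ?addr0// => j jk.
  by rewrite (negbTE jk) mulr0.
rewrite big_seq big1// => j js; case: eqP => [jk|]; last by rewrite mulr0.
by rewrite -jk js in ks.
Qed.

(** F - proj s F is orthogonal to proj s F, so Pythagoras applies to
F = (F - proj s F) + proj s F. *)
Lemma bessel F s : L2 F -> uniq s ->
  2 * pi * \sum_(k <- s) normc (coef F k) ^+ 2 <= nrm2 F.
Proof.
move=> lF us; have lP := L2_proj s F; have lH := L2B lF lP.
have H0 : cint (fun t => (F t - proj s F t) * conjc (proj s F t)) = 0.
  rewrite cint_trig_sum// big_map big_seq big1 ?mulr0// => k ks /=.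
  by rewrite coefB// coef_proj// ks subrr mulr0.
have FE : F = (fun t => (F t - proj s F t) + proj s F t).
  by apply: funext => t; rewrite subrK.
rewrite {2}FE nrm2_pythagoras//.
have PE : cint (fun t => proj s F t * conjc (proj s F t)) =
    (2 * pi * \sum_(k <- s) normc (coef F k) ^+ 2)%:C.
  rewrite cint_trig_sum// big_map [RHS](rmorphM (real_complex R)).
  rewrite [X in _ = _ * X](rmorph_sum (real_complex R)); congr (_ * _).
  rewrite big_seq [RHS]big_seq; apply: eq_bigr => k ks.
  by rewrite /= coef_proj// ks mulrC mulcJ.
by rewrite [nrm2 (proj s F)]nrm2E PE/= lerDr nrm2_ge0.
Qed.

(** The two hypotheses say that F - proj s F is orthogonal to proj s F and to
trig_sum r.  The frequencies of r need not lie in s: a coefficient of F that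
vanishes does as well. *)
Lemma best_approximation F s (r : seq (R[i] * int)) : L2 F ->
  (forall x, x \in s -> coef (fun t => F t - proj s F t) x = 0) ->
  (forall x : R[i] * int, x \in r -> coef (fun t => F t - proj s F t) x.2 = 0) ->
  nrm2 (fun t => F t - proj s F t) <= nrm2 (fun t => F t - trig_sum r t).
Proof.
move=> lF Hs Hr; have lP := L2_proj s F; have lH := L2B lF lP.
pose r' := [seq (coef F k, k) | k <- s] ++ [seq (- x.1, x.2) | x <- r].
have rE t : trig_sum r' t = proj s F t - trig_sum r t.
  rewrite /trig_sum big_cat/= projE !big_map/= -sumrN; congr (_ + _).
  by apply: eq_bigr => x _; rewrite mulNr.
have -> : (fun t => F t - trig_sum r t) = (fun t => (F t - proj s F t) + trig_sum r' t).
  by apply: funext => t; rewrite rE addrA subrK.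
rewrite (nrm2_pythagoras lH (L2_trig_sum r')) ?lerDl ?nrm2_ge0//.
rewrite cint_trig_sum// big_cat !big_map/= big_seq big1 => [|k ks]; last first.
  by rewrite Hs// mulr0.
by rewrite big_seq big1 ?addr0 ?mulr0// => x xr; rewrite Hr// mulr0.
Qed.

(** Euler's formulas for cosine and sine. *)
Lemma trigpoly_trig_sum p : trigpoly p -> exists r, forall t, (p t)%:C = trig_sum r t.
Proof.
elim => [a|||p1 p2 _ [r1 h1] _ [r2 h2]|p1 p2 _ [r1 h1] _ [r2 h2]].
- by exists [:: (a%:C, 0)] => t; rewrite /trig_sum big_seq1 expz0 mulr1.
- exists [:: ((1 / 2)%:C, 1); ((1 / 2)%:C, -1)] => t.
  rewrite /trig_sum !big_cons big_nil /= addr0.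
  apply: eq_complexP; rewrite ?cReD ?cImD ?cReM ?cImM/= ?mulN1r ?mul1r ?cosN ?sinN;
   lra.
- exists [:: (0 +i* (- (1 / 2)), 1); (0 +i* (1 / 2), -1)] => t.
  rewrite /trig_sum !big_cons big_nil /= addr0.
  apply: eq_complexP; rewrite ?cReD ?cImD ?cReM ?cImM/= ?mulN1r ?mul1r ?cosN ?sinN;
   lra.
- by exists (r1 ++ r2) => t; rewrite rmorphD/= h1 h2 /trig_sum big_cat.
- exists [seq (x.1 * y.1, x.2 + y.2) | x <- r1, y <- r2] => t.
  rewrite rmorphM/= h1 h2 /trig_sum big_allpairs_dep/= mulr_suml.
  apply: eq_bigr => x _; rewrite mulr_sumr; apply: eq_bigr => y _.
  by rewrite expzD mulrACA.
Qed.

Lemma trig_sum_dense F : L2 F -> forall e : R, 0 < e ->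
  exists r, nrm2 (fun t => F t - trig_sum r t) < e.
Proof.
move=> [rF iF] e e0; have e2 : 0 < e / 2 by rewrite divr_gt0.
have [_ /(_ _ e2)[p tp pF]] := sqint_approximable rF.
have [_ /(_ _ e2)[q tq qF]] := sqint_approximable iF.
have [[r hr] [u hu]] := (trigpoly_trig_sum tp, trigpoly_trig_sum tq).
exists (r ++ [seq ('i * x.1, x.2) | x <- u]).
have pqE t : trig_sum (r ++ [seq ('i * x.1, x.2) | x <- u]) t = (p t)%:C + 'i * (q t)%:C.
  rewrite hr hu /trig_sum big_cat big_map mulr_sumr; congr (_ + _).
  by apply: eq_bigr => x _; rewrite mulrA.
rewrite /nrm2 (@dint_eq _ _
  (fun t => (Re (F t) - p t) ^+ 2 + (Im (F t) - q t) ^+ 2)); last first.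
  move=> t _; rewrite normc_sqr pqE.
  by rewrite cReB cImB !cReD !cImD !cReM !cImM/=; congr (_ ^+ 2 + _ ^+ 2); ring.
have [_ i1] := sqintB rF (trigpoly_sqint tp).
have [_ i2] := sqintB iF (trigpoly_sqint tq).
by rewrite dintD//; lra.
Qed.

End FourierCoefficients.

(** * Fourier coefficients of products *)

Section Convolution.
Local Open Scope complex_scope.
Variable R : realType.
Implicit Types (F G : R -> R[i]) (f : R[i] -> R[i]).
Local Notation mu := (@lebesgue_measure R).
Local Notation D := (@angles R).
Local Notation Re := complex.Re.
Local Notation Im := complex.Im.

Lemma normr_dint (f g : R -> R) : intble f -> intble g ->
  (forall t, D t -> `|f t| <= g t) -> `|dint f| <= dint g.
Proof.
move=> fi gi fg; rewrite ler_norml -[- dint g]mulN1r -dintZ//.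
apply/andP; split; apply: dint_le => //; try exact: intbleZ.
  by move=> t /fg; rewrite ler_norml mulN1r => /andP[].
by move=> t /fg; rewrite ler_norml => /andP[].
Qed.

(** The integral version of [normc_sum_mul]. *)
Lemma normc_cint_mul F G (s : R) : L2 F -> L2 G -> 0 < s ->
  normc (cint (fun t => F t * G t)) <= s * nrm2 F + s^-1 * nrm2 G.
Proof.
move=> lF lG s0; have [ri ii] := L2_mul lF lG.
have [iF iG] := (nrm2_intble lF, nrm2_intble lG).
have ib : intble (fun t => 1 / 2 * (s * normc (F t) ^+ 2 + s^-1 * normc (G t) ^+ 2)).
  by apply/intbleZ/intbleD; exact: intbleZ.
have bound t : normc (F t * G t) <=
    1 / 2 * (s * normc (F t) ^+ 2 + s^-1 * normc (G t) ^+ 2).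
  rewrite normcM; set a := normc (F t); set b := normc (G t).
  have : 0 <= s^-1 * (s * a - b) ^+ 2 by rewrite mulr_ge0 ?sqr_ge0// invr_ge0 ltW.
  have -> : s^-1 * (s * a - b) ^+ 2 = s * a ^+ 2 + s^-1 * b ^+ 2 - 2 * (a * b).
    by field; rewrite gt_eqF.
  by move=> h; lra.
have -> : s * nrm2 F + s^-1 * nrm2 G =
    dint (fun t => 1 / 2 * (s * normc (F t) ^+ 2 + s^-1 * normc (G t) ^+ 2)) +
    dint (fun t => 1 / 2 * (s * normc (F t) ^+ 2 + s^-1 * normc (G t) ^+ 2)).
  rewrite dintZ; last by apply: intbleD; exact: intbleZ.
  by rewrite dintD; [|exact: intbleZ|exact: intbleZ]; rewrite !dintZ// /nrm2; lra.
apply: le_trans (normc_le_ReIm _) _; apply: lerD; apply: normr_dint => // t _.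
  exact: le_trans (normRe_le _) _.
exact: le_trans (normIm_le _) _.
Qed.

Lemma nrm2_expzM k F : nrm2 (fun t => expz k t * F t) = nrm2 F.
Proof.
apply: dint_eq => t _; rewrite normcM exprMn [normc (expz _ _) ^+ 2]normc_sqr.
by rewrite /expz/= cos2Dsin2 mul1r.
Qed.

Definition neg_freqs N : seq int := [seq - j%:Z | j <- index_iota 0 N].

(** An anti-analytic F is approximated by a trigonometric sum r, whose positive
frequencies are orthogonal to F; once N exceeds the absolute values of the
other ones, the partial sum is at least as close to F as r. *)
Lemma proj_cvg F (e : R) : L2 F -> (forall k, 0 < k -> coef F k = 0) -> 0 < e ->
  exists N0 : nat, forall N, (N0 <= N)%N ->
    nrm2 (fun t => F t - proj (neg_freqs N) F t) < e.
Proof.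
move=> lF F0 e0; have [r rF] := trig_sum_dense lF e0.
exists (\max_(x <- r) absz x.2).+1 => N rN; apply: le_lt_trans rF.
set s := neg_freqs N.
have us : uniq s by rewrite /s /neg_freqs /index_iota map_inj_uniq ?iota_uniq// => i j /oppr_inj[].
have lP := L2_proj s F.
apply: best_approximation => // x xs.
  by rewrite coefB// coef_proj// xs subrr.
rewrite coefB// coef_proj//; case: ifP => [_|]; first by rewrite subrr.
move=> /negP xNs; rewrite subr0 F0// ltNge; apply/negP => x0; apply: xNs.
apply/mapP; exists (absz x.2); last by rewrite lez0_abs// opprK.
rewrite mem_index_iota/=; apply: leq_ltn_trans rN.
by rewrite (big_rem x)//= leq_maxl.
Qed.

(** The formula is exact when F is replaced by a partial sum of its Fourier
series, and multiplication by G is continuous from L2 to L1. *)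
Lemma coef_mul_cvg F G k : L2 F -> (forall k, 0 < k -> coef F k = 0) -> L2 G ->
  ccvg (fun N => \sum_(j < N) coef F (- j%:Z) * coef G (k + j%:Z))
       (coef (fun t => F t * G t) k).
Proof.
move=> lF F0 lG e e0; pose s : R := (nrm2 G + 1) / e.
(* This weight makes the term of G at most e in [normc_cint_mul]; N is then
   chosen so that the term of F - proj is at most e too. *)
have s0 : 0 < s by rewrite divr_gt0// ltr_wpDl// nrm2_ge0.
have [N0 HN] : exists N0 : nat, forall N, (N0 <= N)%N ->
    nrm2 (fun t => F t - proj (neg_freqs N) F t) < e / s.
  by apply: proj_cvg => //; rewrite divr_gt0.
exists N0 => N N0N.
have lP := L2_proj (neg_freqs N) F.
have lH := L2B lF lP; have leG := L2_expzM (- k) lG.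
have -> : \sum_(j < N) coef F (- j%:Z) * coef G (k + j%:Z) =
    ((2 * pi)^-1)%:C *
    cint (fun t => proj (neg_freqs N) F t * (expz (- k) t * G t)).
  transitivity (((2 * pi)^-1)%:C *
    cint (fun t => \sum_(j <- (neg_freqs N))
                 coef F j * (expz j t * (expz (- k) t * G t)))); last first.
    congr (_ * _); apply: cint_eq => t _; rewrite projE mulr_suml.
    by apply: eq_bigr => j _; rewrite mulrA.
  rewrite cint_sum; last by move=> j; apply/cintbleZ/L2_mul => //; exact: L2_expz.
  rewrite mulr_sumr big_map big_mkord.
  apply: eq_bigr => j _; rewrite cintZ; last by apply: L2_mul => //; exact: L2_expz.
  rewrite [coef G _]coefE mulrCA; congr (_ * (_ * _)); apply: cint_eq => t _.
  by rewrite opprD expzD; ring.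
have -> : coef (fun t => F t * G t) k =
    ((2 * pi)^-1)%:C * cint (fun t => F t * (expz (- k) t * G t)).
  rewrite coefE; congr (_ * _); apply: cint_eq => t _; ring.
rewrite -mulrBr -normcN -mulrN opprB.
have -> : cint (fun t => F t * (expz (- k) t * G t)) -
    cint (fun t => proj (neg_freqs N) F t * (expz (- k) t * G t)) =
    cint (fun t => (F t - proj (neg_freqs N) F t) * (expz (- k) t * G t)).
  rewrite -[- cint _]mulN1r -cintZ; last exact: L2_mul.
  rewrite -cintD; [|exact: L2_mul|by apply/cintbleZ/L2_mul].
  by apply: cint_eq => t _; ring.
rewrite normcM; apply: (@le_lt_trans _ _ ((2 * pi)^-1 * (e + e))); last first.
  have := @pi_ge2 R => p2; have p0 : 0 < 2 * pi :> R := pi2_gt0 R.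
  rewrite mulrC ltr_pdivrMr//; nra.
apply: ler_pM; rewrite ?normc_ge0//.
  by rewrite /normc/= expr0n/= addr0 sqrtr_sqr ger0_norm// invr_ge0 ltW// pi2_gt0.
apply: le_trans (normc_cint_mul lH leG s0) _; rewrite nrm2_expzM; apply: lerD.
  by have := HN N N0N; rewrite ltr_pdivlMr// mulrC => /ltW.
rewrite /s invf_div mulrAC ler_pdivrMr ?ltr_wpDl ?nrm2_ge0// ler_wpM2l ?ltW//.
by rewrite ltrDl.
Qed.

Lemma fourierE f : fourier f = coef (fun t => f (expi t)).
Proof. by []. Qed.

Lemma circle_L2P f : circle_L2 f -> L2 (fun t => f (expi t)).
Proof.
move=> [[mr mi] fi].
have mn : measurable_fun D (fun t => normc (f (expi t)) ^+ 2).
  by under eq_fun do rewrite normc_sqr; apply: measurable_funD; exact: measurable_funX.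
have inn : intble (fun t => normc (f (expi t)) ^+ 2).
  apply/integrableP; split; first exact/measurable_EFinP.
  by under eq_integral do rewrite /= ger0_norm ?sqr_ge0//.
by split; [apply: (sqint_le mr _ inn)|apply: (sqint_le mi _ inn)] => t _;
  rewrite normc_sqr ?lerDl ?lerDr sqr_ge0.
Qed.

Lemma circle_boundedP f : circle_measurable f -> circle_bounded f ->
  L2 (fun t => f (expi t)).
Proof.
move=> [mr mi] [K fK]; split; [apply: (sqint_bounded mr)|apply: (sqint_bounded mi)] => t Dt.
  exact: le_trans (normRe_le _) (fK _ Dt).
exact: le_trans (normIm_le _) (fK _ Dt).
Qed.

Lemma H2P f : H2 f -> L2 (fun t => f (expi t)) /\ forall k, k < 0 -> fourier f k = 0.
Proof. by move=> [/circle_L2P]. Qed.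

Lemma H2barP f : H2bar f -> L2 (fun t => f (expi t)) /\ forall k, 0 < k -> fourier f k = 0.
Proof.
move=> [g /H2P[lg g0] fg].
have -> : f = (fun z => conjc (g z)) by apply: funext.
split; first exact: L2_conj.
move=> k k0; rewrite fourierE coef_conj//.
by rewrite -[coef _ _]/(fourier g (- k)) g0 ?oppr_lt0// rmorph0.
Qed.

Lemma ae_angles_impl (P Q : R -> Prop) : (forall t, D t -> P t -> Q t) ->
  {ae mu, forall t, D t -> P t} -> {ae mu, forall t, D t -> Q t}.
Proof.
move=> PQ [N [mN N0 NP]]; exists N; split=> // t nQ; apply: NP => DP.
by apply: nQ => Dt; apply: PQ => //; exact: DP.
Qed.

Lemma dint_ae (f g : R -> R) : measurable_fun D f -> measurable_fun D g ->
  {ae mu, forall t, D t -> f t = g t} -> dint f = dint g.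
Proof.
move=> mf mg fg; congr fine; apply: (ae_eq_integral (mu := mu)).
- exact: measurable_angles.
- exact/measurable_EFinP.
- exact/measurable_EFinP.
- by apply: ae_angles_impl fg => t _ ->.
Qed.

Lemma coef_ae F G k : cintble F -> cintble G ->
  {ae mu, forall t, D t -> F t = G t} -> coef F k = coef G k.
Proof.
move=> [/intble_measurable rF /intble_measurable iF].
move=> [/intble_measurable rG /intble_measurable iG] FG.
have [/intble_measurable re /intble_measurable ie] := L2_intble (L2_expz R (- k)).
rewrite !coefE; congr (_ * (_ +i* _)); apply: dint_ae.
- under eq_fun do rewrite cReM.
  by apply: measurable_funB; apply: measurable_funM.
- under eq_fun do rewrite cReM.
  by apply: measurable_funB; apply: measurable_funM.
- by apply: ae_angles_impl FG => t _ ->.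
- under eq_fun do rewrite cImM.
  by apply: measurable_funD; apply: measurable_funM.
- under eq_fun do rewrite cImM.
  by apply: measurable_funD; apply: measurable_funM.
- by apply: ae_angles_impl FG => t _ ->.
Qed.

End Convolution.

Section FourierSequences.
Local Open Scope complex_scope.
Variable R : realType.
Implicit Types (F : R -> R[i]) (f : R[i] -> R[i]).
Local Notation D := (@angles R).

Lemma sqsum_coef F d n : L2 F -> sqsum n (fun k => coef F (d + k%:Z)) <= (2 * pi)^-1 * nrm2 F.
Proof.
move=> lF; rewrite ler_pdivlMl ?pi2_gt0//.
have us : uniq [seq d + k%:Z | k <- index_iota 0 n].
  by rewrite /index_iota map_inj_uniq ?iota_uniq// => i j /addrI[].
by have := bessel lF us; rewrite big_map big_mkord.
Qed.

Lemma sqsum_coefN F d n : L2 F -> sqsum n (fun k => coef F (d - k%:Z)) <= (2 * pi)^-1 * nrm2 F.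
Proof.
move=> lF; rewrite ler_pdivlMl ?pi2_gt0//.
have us : uniq [seq d - k%:Z | k <- index_iota 0 n].
  by rewrite /index_iota map_inj_uniq ?iota_uniq// => i j /addrI/oppr_inj[].
by have := bessel lF us; rewrite big_map big_mkord.
Qed.

Lemma circle_ae2 (P Q S : R[i] -> Prop) : (forall z, P z -> Q z -> S z) ->
  circle_ae P -> circle_ae Q -> circle_ae S.
Proof.
move=> PQS [N1 [mN1 N10 NP]] [N2 [mN2 N20 NQ]]; exists (N1 `|` N2); split.
- exact: measurableU.
- exact: null_set_setU.
move=> t nS; apply: contrapT => /not_orP[n1 n2]; apply: nS => Dt.
have /contrapT Pt := (fun h => n1 (NP t h)).
have /contrapT Qt := (fun h => n2 (NQ t h)).
by apply: PQS; [exact: Pt|exact: Qt].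
Qed.

Variables phi phim phip : R[i] -> R[i].
Hypothesis phi_measurable : circle_measurable phi.
Hypothesis phi_bounded : circle_bounded phi.
Hypothesis phi_factorization : wiener_hopf phi phim phip.

(** Almost everywhere, phip is the product of 1 / phim and phi. *)
Lemma fourier_phip_cvg k :
  ccvg (fun N => \sum_(j < N) fourier (fun z => (phim z)^-1) (- j%:Z) * fourier phi (k + j%:Z))
       (fourier phip k).
Proof.
have [ae_eq [_ ae_m] [/H2P[lp _] _] [_ /H2barP[lmV mV0]]] := phi_factorization.
have lphi := circle_boundedP phi_measurable phi_bounded.
have -> : fourier phip k = coef (fun t => (phim (expi t))^-1 * phi (expi t)) k.
  apply: coef_ae.
  - exact: L2_intble.
  - exact: L2_mul.
  - apply: (circle_ae2 (S := fun z => phip z = (phim z)^-1 * phi z)) ae_eq ae_m => z -> z0.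
    by rewrite mulKf.
exact: coef_mul_cvg.
Qed.

(** The product of 1 / phim and phim is 1 almost everywhere. *)
(** The terms beyond K vanish, since phim has no positive frequencies. *)
Lemma fourier_phim_inverse_cvg k :
  ccvg (fun N => \sum_(j < N) fourier (fun z => (phim z)^-1) (- j%:Z) * fourier phim (k + j%:Z))
       (k == 0)%:R.
Proof.
have [_ [_ ae_m] _ [/H2barP[lm _] /H2barP[lmV mV0]]] := phi_factorization.
have -> : (k == 0)%:R = coef (fun t => (phim (expi t))^-1 * phim (expi t)) k.
  rewrite eq_sym -(coef_expz R 0 k) (funext (@expz0 R)); apply: coef_ae.
  - by apply: L2_intble; exact: L2_cst.
  - exact: L2_mul.
  - apply: (circle_ae2 (S := fun z => 1 = (phim z)^-1 * phim z) _ ae_m ae_m) => z z0 _.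
    by rewrite mulVf.
exact: coef_mul_cvg.
Qed.

End FourierSequences.

(** * Toeplitz operators and finite sections *)

Section Toeplitz.
Local Open Scope complex_scope.
Variable R : realType.
Variable phi : R[i] -> R[i].
Implicit Types (u v x : nat -> R[i]).
Local Notation c := (fourier phi).
Local Notation T := (toeplitz_op phi).
Hypothesis T_bounded : l2_bounded_linear T.

Lemma sum_trunc n N (h u : nat -> R[i]) : (n <= N)%N ->
  \sum_(0 <= k < N) h k * trunc n u k = \sum_(k < n) h k * u k.
Proof.
move=> nN; rewrite big_mkord -(subnKC nN) big_split_ord/= [X in _ + X]big1 ?addr0.
  by apply: eq_bigr => k _; rewrite /trunc ltn_ord.
by move=> k _; rewrite /trunc ltnNge leq_addr mulr0.
Qed.

Lemma toeplitz_trunc n u i : T (trunc n u) i = \sum_(k < n) c (i%:Z - k%:Z) * u k.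
Proof.
by apply: cseries_lim; apply: (@ccvg_near _ _ _ n) => N nN; rewrite sum_trunc.
Qed.

Lemma toeplitz_cvg u i : l2 u ->
  ccvg (fun n => \sum_(k < n) c (i%:Z - k%:Z) * u k) (T u i).
Proof.
move=> lu; apply: eq_ccvg (bounded_linear_trunc_cvg i T_bounded lu) => n.
exact: toeplitz_trunc.
Qed.

Definition shift N u k : R[i] := if (k < N)%N then 0 else u (k - N)%N.

Lemma l2_shift N u : l2 u -> l2 (shift N u).
Proof.
move=> lu; apply: (@l2_bounded _ _ (l2norm u ^+ 2)) => n.
apply: le_trans (sqsum_le_l2norm n lu); apply: le_trans (sqsum_le _ (leq_addl N n)) _.
rewrite /sqsum big_split_ord/= big1 ?add0r.
  apply: ler_sum => k _; rewrite /shift ltnNge leq_addr/= addKn lexx//.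
by move=> k _; rewrite /shift ltn_ord normc0 expr0n.
Qed.

(** The coefficient at p of the product of phi and the series with coefficients
u.  For negative p it is an entry of T applied to a shift of u to the right, so
the boundedness of T on the half-line is enough to make sense of it. *)
Definition laurent u (p : int) : R[i] :=
  T (shift (absz p) u) (absz (p + (absz p)%:Z)).

Lemma toeplitz_shift_cvg u N j : l2 u ->
  ccvg (fun n => \sum_(k < n) c (j%:Z - N%:Z - k%:Z) * u k) (T (shift N u) j).
Proof.
move=> lu; have := ccvg_addn N (toeplitz_cvg j (l2_shift N lu)).
apply: eq_ccvg => n; rewrite addnC big_split_ord/= big1 ?add0r => [|k _]; last first.
  by rewrite /shift ltn_ord mulr0.
apply: eq_bigr => k _; rewrite /shift ltnNge leq_addr/= addKn; congr (c _ * _).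
by rewrite PoszD; lia.
Qed.

Lemma laurent_cvg u p : l2 u -> ccvg (fun n => \sum_(k < n) c (p - k%:Z) * u k) (laurent u p).
Proof.
move=> lu; apply: eq_ccvg (toeplitz_shift_cvg _ _ lu) => n.
by apply: eq_bigr => k _; congr (c _ * _); lia.
Qed.

(** The entry does not depend on the amount of the shift. *)
Lemma laurentE u N j : l2 u -> laurent u (j%:Z - N%:Z) = T (shift N u) j.
Proof.
by move=> lu; apply: (ccvg_unique (laurent_cvg _ lu)); exact: toeplitz_shift_cvg.
Qed.

Lemma laurent_nat u (j : nat) : l2 u -> laurent u j%:Z = T u j.
Proof.
by move=> lu; apply: (ccvg_unique (laurent_cvg _ lu)); exact: toeplitz_cvg.
Qed.

Section FiniteSection.
Hypothesis Tn : uniformly_invertible (toeplitz_mx phi).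

Lemma cvnorm_sqr n (x : 'cV[R[i]]_n) : cvnorm x ^+ 2 = \sum_(i < n) normc (x i 0) ^+ 2.
Proof. by rewrite sqr_sqrtr//; apply: sumr_ge0 => i _; exact: sqr_ge0. Qed.

Lemma cvnormZ n (a : R) (x : 'cV[R[i]]_n) : cvnorm (a%:C *: x) = `|a| * cvnorm x.
Proof.
rewrite -sqrtr_sqr -sqrtrM ?sqr_ge0//; congr Num.sqrt; rewrite mulr_sumr.
by apply: eq_bigr => i _; rewrite mxE normcM normc_real exprMn real_normK ?num_real.
Qed.

(** The operator norm only tests vectors in the unit ball; others are rescaled. *)
Lemma cvnorm_mulmx n (A : 'M[R[i]]_n) (K : R) (x : 'cV[R[i]]_n) :
  (opnorm A <= K%:E)%E -> cvnorm (A *m x) <= K * cvnorm x.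
Proof.
move=> AK; have [x0|x0] := eqVneq (cvnorm x) 0.
  suff -> : x = 0.
    have c0 : cvnorm (0 : 'cV[R[i]]_n) = 0.
      by rewrite /cvnorm big1 ?sqrtr0// => i _; rewrite mxE normc0 expr0n.
    by rewrite mulmx0 c0 mulr0.
  apply/matrixP => i j; rewrite ord1 mxE; apply: eq0_normc; apply/eqP.
  rewrite -sqrf_eq0; have /eqP := cvnorm_sqr x.
  rewrite x0 expr0n eq_sym psumr_eq0/=; last by move=> k _; exact: sqr_ge0.
  by move=> /allP/(_ i); rewrite mem_index_enum => /(_ isT).
have xp : 0 < cvnorm x by rewrite lt_neqAle eq_sym x0 sqrtr_ge0.
have := ereal_sup_ubound; move=> /(_ R _ (cvnorm (A *m ((cvnorm x)^-1%:C *: x)))%:E) ub.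
have : ((cvnorm (A *m ((cvnorm x)^-1%:C *: x)))%:E <= K%:E)%E.
  apply: le_trans AK; apply: ub; exists ((cvnorm x)^-1%:C *: x) => //=.
  by rewrite cvnormZ ger0_norm ?invr_ge0 ?sqrtr_ge0// mulVf.
rewrite lee_fin -scalemxAr cvnormZ ger0_norm ?invr_ge0 ?sqrtr_ge0//.
by rewrite ler_pdivrMl// mulrC.
Qed.

(** Let w be T applied to the tail of x.  The truncation x_n satisfies
T_n x_n = v_n - w_n, so T_n^-1 v_n - x_n = T_n^-1 w_n, and this tends to 0
because the norms of T_n^-1 are bounded while w tends to 0 in l2. *)
Lemma finite_section (b v x : nat -> R[i]) (M : R) (l : R[i]) :
  l2 x -> (forall i, T x i = v i) -> (forall n, sqsum n b <= M) ->
  ccvg (fun n => \sum_(k < n) b k * x k) l ->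
  ccvg (fun n => \sum_(k < n) b k *
           (invmx (toeplitz_mx phi n) *m \col_(i < n) v i) k 0) l.
Proof.
move=> lx Tx bM bl; have [N0 [Tu [K TK]]] := Tn.
suff : ccvg (fun n => \sum_(k < n) b k *
           (invmx (toeplitz_mx phi n) *m \col_(i < n) v i) k 0 -
         \sum_(k < n) b k * x k) 0.
  by move=> /ccvgD/(_ bl); rewrite add0r; apply: eq_ccvg => n; rewrite subrK.
move=> e e0; have M0 : 0 <= M := le_trans (sqsum_ge0 0 b) (bM 0).
pose s := e / (4 * (M + 1)).
have s0 : 0 < s by rewrite divr_gt0// mulr_gt0// ltr_wpDl.
(* With the weight s the contribution of b is at most e / 4, and so is that of
   T_n^-1 w once the squared norm of w is at most d. *)
pose d := s * (e / 4) / (K ^+ 2 + 1).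
have K1 : 0 < K ^+ 2 + 1 by rewrite ltr_wpDl ?sqr_ge0.
have d0 : 0 < d by rewrite divr_gt0// mulr_gt0// divr_gt0.
have [N1 hN1] := bounded_linear_tail T_bounded lx d0.
exists (maxn N0 N1) => n; rewrite geq_max => /andP[n0 n1].
rewrite subr0 -sumrB; set w := \col_(i < n) T (tail n x) i.
have yE : invmx (toeplitz_mx phi n) *m \col_(i < n) v i =
    \col_(i < n) x i + invmx (toeplitz_mx phi n) *m w.
  have -> : \col_(i < n) v i = toeplitz_mx phi n *m (\col_(i < n) x i) + w.
    apply/matrixP => i j; rewrite !mxE -Tx (bounded_linear_split n i T_bounded lx).
    rewrite addrC toeplitz_trunc; congr (_ + _).
    by apply: eq_bigr => k _; rewrite !mxE.
  by rewrite mulmxDr mulKmx// Tu.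
set y := invmx _ *m w in yE.
rewrite (eq_bigr (fun k : 'I_n => b k * y k 0)); last first.
  by move=> k _; rewrite yE mxE [X in b k * (X + _)]mxE mulrDr addrAC subrr add0r.
apply: le_lt_trans (normc_sum_mul _ _ _ s0) _.
have h1 : s * (\sum_(k < n) normc (b k) ^+ 2) <= e / 4.
  apply: (@le_trans _ _ (s * M)); first by rewrite ler_wpM2l ?(ltW s0)//; exact: bM.
  rewrite /s mulrAC ler_pdivrMr ?mulr_gt0 ?ltr_wpDl//; nra.
have h2 : s^-1 * (\sum_(k < n) normc (y k 0) ^+ 2) <= e / 4.
  rewrite ler_pdivrMl// -cvnorm_sqr.
  have yw := cvnorm_mulmx w (TK n n0).
  have w2 : cvnorm w ^+ 2 <= d.
    rewrite cvnorm_sqr; apply: le_trans (hN1 n n1 n); apply: ler_sum => k _.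
    by rewrite mxE lexx.
  have : cvnorm y ^+ 2 <= (K * cvnorm w) ^+ 2.
    by rewrite lerXn2r ?nnegrE ?sqrtr_ge0// (le_trans _ yw)// sqrtr_ge0.
  rewrite exprMn => /le_trans; apply.
  apply: (@le_trans _ _ (K ^+ 2 * d)); first by rewrite ler_wpM2l ?sqr_ge0.
  have se : 0 <= s * (e / 4) by rewrite mulr_ge0 ?(ltW s0)// divr_ge0// ltW.
  by rewrite /d mulrA ler_pdivrMr// mulrC ler_wpM2l// lerDl.
lra.
Qed.

End FiniteSection.

End Toeplitz.

(** * The residual of the Toeplitz system *)

Arguments fourier : simpl never.

Section WienerHopf.
Local Open Scope complex_scope.
Variable R : realType.
Variables phi phim phip : R[i] -> R[i].
Hypothesis phi_measurable : circle_measurable phi.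
Hypothesis phi_bounded : circle_bounded phi.
Hypothesis T_bounded : l2_bounded_linear (toeplitz_op phi).
Hypothesis phi_factorization : wiener_hopf phi phim phip.
Local Notation c := (fourier phi).
Local Notation a := (fourier phim).
Local Notation b := (fourier phip).
Local Notation alpha := (fourier (fun z => (phim z)^-1)).
Local Notation T := (toeplitz_op phi).

Lemma fourier_phim_pos k : 0 < k -> a k = 0.
Proof. by have [_ _ _ [/H2barP[_ h] _]] := phi_factorization; exact: h. Qed.

Lemma fourier_phip_neg k : k < 0 -> b k = 0.
Proof. by have [_ _ [/H2P[_ h] _] _] := phi_factorization; exact: h. Qed.

(** With w also denoting its power series, the sum is the coefficient at 0 of
(1 / phim) phi w = phip w, which vanishes since phip is analytic and w_0 = 0.  For a truncation of w the sums may be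
interchanged; the remainder is small by the boundedness of T. *)
Lemma phim_inv_toeplitz (w : nat -> R[i]) : l2 w -> w 0 = 0 ->
  ccvg (fun J => \sum_(j < J) alpha (- j%:Z) * T w j) 0.
Proof.
move=> lw w0 e e0.
have [M hM] : exists M, forall n, sqsum n (fun j => alpha (- j%:Z)) <= M.
  have [_ _ _ [_ /H2barP[lV _]]] := phi_factorization.
  exists ((2 * pi)^-1 * nrm2 (fun t => (phim (expi t))^-1)) => n.
  by have := sqsum_coefN 0 n lV; under [X in sqsum n X]eq_fun do rewrite sub0r.
have M0 : 0 <= M := le_trans (sqsum_ge0 0 _) (hM 0).
pose s := e / (4 * (M + 1)).
have s0 : 0 < s by rewrite divr_gt0// mulr_gt0// ltr_wpDl.
have d0 : 0 < s * (e / 4) by rewrite mulr_gt0// divr_gt0.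
have [K hK] := bounded_linear_tail T_bounded lw d0.
have head0 : ccvg (fun J => \sum_(j < J) alpha (- j%:Z) * T (trunc K w) j) 0.
  have wb0 : \sum_(k < K) w k * b (- k%:Z) = 0.
    rewrite big1// => k _; case: (val k) => [|n]; first by rewrite w0 mul0r.
    by rewrite fourier_phip_neg ?mulr0.
  suff : ccvg (fun J => \sum_(j < J) alpha (- j%:Z) * T (trunc K w) j)
      (\sum_(k < K) w k * b (- k%:Z)) by rewrite wb0.
  apply: (@eq_ccvg _ (fun J => \sum_(k < K) w k *
      \sum_(j < J) alpha (- j%:Z) * c (- k%:Z + j%:Z))).
    move=> J; under eq_bigr do rewrite mulr_sumr.
    rewrite exchange_big/=; apply: eq_bigr => j _; rewrite toeplitz_trunc mulr_sumr.
    by apply: eq_bigr => k _; rewrite mulrCA [c _ * _]mulrC addrC.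
  apply: ccvg_sum => k; apply: ccvg_mull.
  exact: fourier_phip_cvg phi_measurable phi_bounded phi_factorization _.
have [|N hN] := head0 (e / 2); first by rewrite divr_gt0.
exists N => J /hN; rewrite !subr0 => hJ.
have -> : \sum_(j < J) alpha (- j%:Z) * T w j =
    \sum_(j < J) alpha (- j%:Z) * T (tail K w) j +
    \sum_(j < J) alpha (- j%:Z) * T (trunc K w) j.
  by rewrite -big_split; apply: eq_bigr => j _;
    rewrite (bounded_linear_split K j T_bounded lw) mulrDr.
apply: le_lt_trans (le_normcD _ _) _.
have := normc_sum_mul (index_enum 'I_J) (fun j : 'I_J => alpha (- (j : nat)%:Z))
  (fun j : 'I_J => T (tail K w) j) s0.
have h1 : s * sqsum J (fun j => alpha (- j%:Z)) <= e / 4.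
  apply: (@le_trans _ _ (s * M)); first by rewrite ler_wpM2l ?(ltW s0).
  rewrite /s mulrAC ler_pdivrMr ?mulr_gt0 ?ltr_wpDl//; nra.
have h2 : s^-1 * sqsum J (T (tail K w)) <= e / 4.
  by rewrite ler_pdivrMl// hK.
rewrite -/(sqsum J (fun j => alpha (- j%:Z))) -/(sqsum J (T (tail K w))); lra.
Qed.

Variables (x : nat -> R[i]) (q : int).
Hypothesis lx : l2 x.
Hypothesis Tx : forall i : nat, T x i = c (i%:Z - q).

(** The coefficient at p of phi (z^q - h), where h has the coefficients x. *)
Definition residual (p : int) : R[i] := c (p - q) - laurent phi x p.

Lemma residual_nat (i : nat) : residual i%:Z = 0.
Proof. by rewrite /residual laurent_nat// Tx subrr. Qed.

(** The coefficient at -(n + 1) of phip (z^q - h), the quotient of the residual by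
phim: the part phip h does not contribute by [phim_inv_toeplitz].  The sum is
finite since the residual vanishes at nonnegative indices. *)
Lemma residual_convolution (n J : nat) : (n < J)%N ->
  \sum_(j < J) alpha (- j%:Z) * residual (j%:Z - n.+1%:Z) = b (- n.+1%:Z - q).
Proof.
move=> nJ; apply: (@ccvg_unique _
  (fun J => \sum_(j < J) alpha (- j%:Z) * residual (j%:Z - n.+1%:Z))).
  apply: (@ccvg_near _ _ _ J) => K JK.
  rewrite -(subnKC JK) big_split_ord/= [X in _ + X]big1 ?addr0// => j _.
  have -> : (J + j)%N%:Z - n.+1%:Z = (J + j - n.+1)%N%:Z by lia.
  by rewrite residual_nat mulr0.
have h1 := fourier_phip_cvg phi_measurable phi_bounded phi_factorization (- n.+1%:Z - q).
have h2 := phim_inv_toeplitz (l2_shift n.+1 lx) (erefl _).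
have := ccvgB h1 h2; rewrite subr0; apply: eq_ccvg => K.
rewrite -sumrB; apply: eq_bigr => j _.
rewrite -mulrBr /residual laurentE//.
by have -> : j%:Z - n.+1%:Z - q = - n.+1%:Z - q + j%:Z by lia.
Qed.

(** The terms beyond K vanish, since phim has no positive frequencies. *)
Lemma fourier_phim_inverse (k : int) (K : nat) : 0 < k + K%:Z ->
  \sum_(j < K) alpha (- j%:Z) * a (k + j%:Z) = (k == 0)%:R.
Proof.
move=> kK; apply: (@ccvg_unique _
  (fun N => \sum_(j < N) alpha (- j%:Z) * a (k + j%:Z))); last first.
  exact: fourier_phim_inverse_cvg phi_factorization _.
apply: (@ccvg_near _ _ _ K) => N KN.
rewrite -(subnKC KN) big_split_ord/= [X in _ + X]big1 ?addr0// => j _.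
by rewrite fourier_phim_pos ?mulr0//; lia.
Qed.

(** Multiplying the quotient of [residual_convolution] by phim gives back the
residual.  The summation bounds are all set to K, which adds only zero terms. *)
Lemma residual_sum (p : int) (K : nat) : (absz p < K)%N ->
  \sum_(i < K) a (p + i.+1%:Z) * b (- i.+1%:Z - q) = residual p.
Proof.
move=> pK.
(* The substitution i = l + j: the terms i < j vanish by [residual_nat], and the
   terms l >= K - j because p + K > 0. *)
have reindex (j : nat) : (j < K)%N ->
    \sum_(i < K) a (p + i.+1%:Z) * residual (j%:Z - i.+1%:Z) =
    \sum_(l < K) a (p + l.+1%:Z + j%:Z) * residual (- l.+1%:Z).
  move=> /ltnW jK.
  rewrite -[in LHS](subnKC jK) -[in RHS](subnK jK) !big_split_ord/=.
  rewrite [X in X + _]big1 ?add0r => [|i _]; last first.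
    have -> : j%:Z - i.+1%:Z = (j - i.+1)%N%:Z by have := ltn_ord i; lia.
    by rewrite residual_nat mulr0.
  rewrite [X in _ = _ + X]big1 ?addr0 => [|l _]; last first.
    by rewrite fourier_phim_pos ?mul0r//; lia.
  by apply: eq_bigr => l _; congr (a _ * residual _); lia.
transitivity (\sum_(i < K) \sum_(j < K)
    alpha (- j%:Z) * (a (p + i.+1%:Z) * residual (j%:Z - i.+1%:Z))).
  apply: eq_bigr => i _; rewrite -(residual_convolution (ltn_ord i)) mulr_sumr.
  by apply: eq_bigr => j _; rewrite mulrCA.
rewrite exchange_big/=; under eq_bigr => j _ do rewrite -mulr_sumr (reindex _ (ltn_ord j)) mulr_sumr.
rewrite exchange_big/=.
transitivity (\sum_(l < K) (p + l.+1%:Z == 0)%:R * residual (- l.+1%:Z)).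
  apply: eq_bigr => l _; rewrite -(@fourier_phim_inverse _ K); last by lia.
  by rewrite mulr_suml; apply: eq_bigr => j _; rewrite mulrA.
case: p pK {reindex} => [p|p] pK.
  rewrite residual_nat big1// => l _; case: eqP => [|_]; last by rewrite mul0r.
  by lia.
have pK' : (p < K)%N by move: pK; lia.
rewrite (bigD1 (Ordinal pK'))//= big1 ?addr0 => [|l lp]; last first.
  case: eqP => [E|_]; last by rewrite mul0r.
  by exfalso; move/eqP: lp; apply; apply: val_inj => /=; lia.
have -> : (Negz p + p.+1%:Z == 0)%:R = 1 :> R[i] by rewrite (_ : _ == 0); [|lia].
by rewrite mul1r NegzE.
Qed.

Lemma residual_cseries (m : nat) (p0 q0 : int) : q = q0 - m%:Z ->
  cseries 1 (fun k => a (p0 + k%:Z - m%:Z) * b (- q0 - k%:Z + m%:Z)) =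
  residual (p0 - m%:Z).
Proof.
move=> qE; apply: cseries_lim; apply: (@ccvg_near _ _ _ (absz (p0 - m%:Z)).+2) => n Kn.
rewrite big_add1 big_mkord -(@residual_sum (p0 - m%:Z) n.-1); last by lia.
apply: eq_bigr => i _.
have -> : p0 - m%:Z + i.+1%:Z = p0 + i.+1%:Z - m%:Z by lia.
by have -> : - i.+1%:Z - q = - q0 - i.+1%:Z + m%:Z by lia.
Qed.

End WienerHopf.

(** * Asymptotics of the determinants *)

(** Right multiplication by a unipotent block matrix makes M block triangular. *)
Lemma det_schur (K : fieldType) (m n : nat) (M : 'M[K]_(m + n)) :
  drsubmx M \in unitmx ->
  \det M / \det (drsubmx M) =
  \det (ulsubmx M - ursubmx M *m (invmx (drsubmx M) *m dlsubmx M)).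
Proof.
move=> uD; set A := ulsubmx M; set B := ursubmx M; set C := dlsubmx M.
set D := drsubmx M in uD *.
have dD : \det D != 0 by rewrite -unitfE -unitmxE.
pose L : 'M[K]_(m + n) := block_mx 1%:M 0 (- (invmx D *m C)) 1%:M.
have ML : M *m L = block_mx (A - B *m (invmx D *m C)) B 0 D.
  rewrite -{1}[M]submxK mulmx_block !mulmx1 !mulmx0 !add0r !mulmxN.
  by rewrite mulKVmx// subrr.
have := congr1 determinant ML; rewrite det_mulmx det_lblock !det1 !mulr1 det_ublock.
by move=> ->; rewrite mulfK.
Qed.

Theorem mainTheorem1 (R : realType) (phi phim phip : R[i] -> R[i])
    (phi_measurable : circle_measurable phi)
    (phi_bounded : circle_bounded phi)
    (T_invertible : l2_invertible (toeplitz_op phi))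
    (phi_factorization : wiener_hopf phi phim phip)
    (m : nat) (m_ge1 : (1 <= m)%N)
    (p q : nat -> int)
    (p_id : forall i : nat, (m <= i)%N -> p i = i%:Z)
    (q_id : forall i : nat, (m <= i)%N -> q i = i%:Z)
    (Tn_unif_invertible : uniformly_invertible (toeplitz_mx phi)) :
  (fun n : nat =>
     \det (\matrix_(i < m + n, j < m + n) fourier phi (p i - q j))
       / \det (toeplitz_mx phi n) : R[i]^o) @ \oo -->
  (\det (\matrix_(i < m, j < m)
     cseries 1 (fun k => fourier phim (p i + k%:Z - m%:Z) *
                         fourier phip (- q j - k%:Z + m%:Z))) : R[i]^o).
Proof.
have [T_bounded [B [[Bl2 _ _] BT]]] := T_invertible.
have lphi := circle_boundedP phi_measurable phi_bounded.
pose v (j : 'I_m) (i : nat) := fourier phi (i%:Z - (q j - m%:Z)).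
have lv j : l2 (v j).
  apply: (@l2_bounded _ _ ((2 * pi)^-1 * nrm2 (fun t => phi (expi t)))) => n.
  rewrite (_ : v j = fun k => coef (fun t => phi (expi t)) (- (q j - m%:Z) + k%:Z)).
    exact: sqsum_coef.
  by apply: funext => k; rewrite /v addrC.
(* The solution of the infinite Toeplitz system for the column j. *)
pose x j := B (v j).
have lx j : l2 (x j) := Bl2 _ (lv j).
have Tx j i : toeplitz_op phi (x j) i = v j i by have [_ ->] := BT _ (lv j).
pose X n : 'M[R[i]]_m := \matrix_(i, j) (fourier phi (p i - q j) -
  \sum_(k < n) fourier phi (p i - m%:Z - k%:Z) *
     (invmx (toeplitz_mx phi n) *m \col_(i < n) v j i) k 0).
have Xcvg i j : ccvg (fun n => X n i j)
    (cseries 1 (fun k => fourier phim (p i + k%:Z - m%:Z) *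
                         fourier phip (- q j - k%:Z + m%:Z))).
  rewrite (residual_cseries phi_measurable phi_bounded T_bounded phi_factorization
    (lx j) (Tx j) _ (erefl _)).
  rewrite /residual.
  have -> : p i - m%:Z - (q j - m%:Z) = p i - q j by lia.
  apply: (@eq_ccvg _ (fun n => fourier phi (p i - q j) -
    \sum_(k < n) fourier phi (p i - m%:Z - k%:Z) *
      (invmx (toeplitz_mx phi n) *m \col_(i < n) v j i) k 0)).
    by move=> n; rewrite mxE.
  apply: ccvgB; first exact: ccvg_cst.
  apply: (finite_section (b := fun k => fourier phi (p i - m%:Z - k%:Z))
    (M := (2 * pi)^-1 * nrm2 (fun t => phi (expi t))) T_bounded Tn_unif_invertible (lx j) (Tx j)).
    by move=> n; apply: (sqsum_coefN _ _ lphi).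
  exact: laurent_cvg.
have [N [Tunit _]] := Tn_unif_invertible.
apply: ccvg_cvg; apply: (@ccvg_ext_near _ (fun n => \det (X n)) _ _ N) => [n Nn|].
  set M := \matrix_(i, j) _.
  have DE : drsubmx M = toeplitz_mx phi n.
    apply/matrixP => i j; rewrite !mxE/= p_id ?leq_addr// q_id ?leq_addr//.
    by congr (fourier phi _); lia.
  rewrite -[in X in _ = _ / X]DE det_schur DE ?Tunit//.
  congr (\det _).
  apply/matrixP => i j; rewrite !mxE/=; congr (_ - _).
  apply: eq_bigr => k _; rewrite !mxE/= q_id ?leq_addr//; congr (_ * _).
    by have -> : p i - (m + k)%N%:Z = p i - m%:Z - k%:Z by lia.
  apply: eq_bigr => l _; rewrite !mxE/= p_id ?leq_addr// /v.
  by have -> : (m + l)%N%:Z - q j = l%:Z - (q j - m%:Z) by lia.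
apply: (@ccvg_det _ m X) => i j; rewrite mxE; exact: Xcvg.
Qed.
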